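(* Let $G=(V,E,\mathsf{wt})$ be a weighted graph with $n$ nodes and $m$ edges, and let $k=|\{v\in V:\mathsf{E}(v)=0\}|+1$. The minimum initial credit value problem for $G$ (computing $\mathsf{E}(u)$ for every $u\in V$) can be solved in $O(k\cdot n\cdot m)$ time and $O(n)$ space.
   Context: A weighted graph $G=(V,E,\mathsf{wt})$ has finite node set $V$, edge set $E\subseteq V\times V$ and weight function $\mathsf{wt}:E\to\mathbb{Z}$; every node has at least one outgoing edge. The weight of a finite path is the sum of its edge weights (the single-node path has weight $0$). For $u\in V$, the (non-positive) minimum initial credit $\mathsf{E}(u)\in\mathbb{Z}_{\le 0}\cup\{-\infty\}$ is the largest value such that there exists an infinite path $(u_1,u_2,\dots)$ with $u_1=u$ for which every finite prefix $P$ satisfies $\mathsf{E}(u)+\mathsf{wt}(P)\le 0$; $\mathsf{E}(u)=-\infty$ if no finite such value exists. (The standard minimum initial credit problem is obtained by negating all weights.) Time is measured in arithmetic and logical operations, space in machine words. *)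

(* Defs.v *)
From mathcomp Require Import all_boot all_order all_algebra.
From Stdlib Require Import ClassicalEpsilon.

Set Implicit Arguments.
Unset Strict Implicit.
Unset Printing Implicit Defensive.

Import Order.TTheory GRing.Theory Num.Theory.
Local Open Scope ring_scope.

(* The values of [wt] outside [edge] are never used. *)
Record wgraph := WGraph {
  node : finType;
  edge : {set node * node};
  wt : node * node -> int;
  edge_total : forall u : node, exists v : node, (u, v) \in edge
}.

Section Credit.
Variable G : wgraph.

Definition infinite_path (p : nat -> node G) : Prop :=
  forall i, (p i, p i.+1) \in edge G.

(* Weight of the finite prefix p 0, ..., p j, which has j edges. *)
Definition prefix_weight (p : nat -> node G) (j : nat) : int :=
  \sum_(i < j) wt (p i, p i.+1).

Definition feasible (u : node G) (x : int) : Prop :=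
  exists p : nat -> node G,
    [/\ p 0%N = u, infinite_path p & forall j, x + prefix_weight p j <= 0].

Definition largest_feasible (u : node G) (x : int) : Prop :=
  feasible u x /\ forall y, feasible u y -> y <= x.

(* The minimum initial credit E(u); [None] stands for -oo. *)
Definition credit (u : node G) : option int :=
  match excluded_middle_informative (exists x, largest_feasible u x) with
  | left ex => Some (proj1_sig (constructive_indefinite_description _ ex))
  | right _ => None
  end.

Lemma feasible_le0 u x : feasible u x -> x <= 0.
Proof.
by move=> [p [_ _ /(_ 0%N)]]; rewrite /prefix_weight big_ord0 addr0.
Qed.

Lemma credit_SomeP u x : credit u = Some x <-> largest_feasible u x.
Proof.
rewrite /credit; case: excluded_middle_informative => [ex|nex]; last first.
  by split=> // Hx; case: nex; exists x.
case: constructive_indefinite_description => y [fy maxy] /=; split.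
  by case=> <-.
by case=> fx maxx; congr Some; apply/le_anti; rewrite maxx // maxy.
Qed.

Lemma credit_NoneP u : credit u = None <-> forall x, ~ feasible u x.
Proof.
rewrite /credit; case: excluded_middle_informative => [ex|nex].
  by split=> // H; exfalso; case: ex => x [/H].
split=> // _ x fx; apply: nex.
have [k hk] : exists k : nat, x + k%:Z = 0.
  have x0 := feasible_le0 fx; exists `|x|%N.
  by rewrite abszE ler0_norm // subrr.
elim: k x fx hk => [|k IH] x fx hk.
  exists x; split=> // y /feasible_le0; rewrite -hk addr0 //.
case: (excluded_middle_informative (exists2 y, feasible u y & x < y)) => [[y fy xy]|no].
  have : feasible u (x + 1).
    case: fy => p [p0 pp hp]; exists p; split=> // j.
    by apply: le_trans (hp j); rewrite lerD2r -ltzD1 ltrD2r.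
  by move/IH; apply; rewrite -addrA -PoszD add1n.
exists x; split=> // y fy; rewrite leNgt; apply/negP => xy.
by apply: no; exists y.
Qed.

End Credit.

(* A random access machine with structured control.  Its working memory is a
   sequence of machine words (integers of absolute value at most [w]) whose size
   never changes; the input is a separate read-only sequence.  Access outside
   the memory or the input, and any value that overflows a word, make the
   machine get stuck. *)

Inductive binop := Add | Sub | Mul | Lt | Eq | And | Or.

Inductive expr :=
  | Const of int
  | Mem of expr
  | Inp of expr
  | Bin of binop & expr & expr.

Inductive cmd :=
  | Skip
  | Store of expr & expr (* address, value *)
  | Seq of cmd & cmd
  | If of expr & cmd & cmd
  | While of expr & cmd.

Definition int_of_bool (b : bool) : int := Posz b.

Definition eval_binop (o : binop) (x y : int) : int :=
  match o with
  | Add => x + y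
  | Sub => x - y
  | Mul => x * y
  | Lt => int_of_bool (x < y)
  | Eq => int_of_bool (x == y)
  | And => int_of_bool ((x != 0) && (y != 0))
  | Or => int_of_bool ((x != 0) || (y != 0))
  end.

Definition fetch (s : seq int) (a : int) : option int :=
  if a is Posz i then onth s i else None.

Definition update (s : seq int) (a v : int) : option (seq int) :=
  if a is Posz i then if (i < size s)%N then Some (set_nth 0 s i v) else None
  else None.

Definition word (w : nat) (x : int) : option int :=
  if (`|x| <= w)%N then Some x else None.

Fixpoint eval (w : nat) (inp mem : seq int) (e : expr) : option int :=
  match e with
  | Const x => word w x
  | Mem a => obind (fetch mem) (eval w inp mem a)
  | Inp a => obind (word w) (obind (fetch inp) (eval w inp mem a))
  | Bin o e1 e2 =>
      if eval w inp mem e1 is Some x then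
        if eval w inp mem e2 is Some y then word w (eval_binop o x y) else None
      else None
  end.

Fixpoint cost (e : expr) : nat :=
  match e with
  | Const _ => 1
  | Mem a => (cost a).+1
  | Inp a => (cost a).+1
  | Bin _ e1 e2 => (cost e1 + cost e2).+1
  end.

(* [exec w inp c mem mem' t]: started with memory [mem], the command [c] halts
   with memory [mem'] after exactly [t] operations. *)
Inductive exec (w : nat) (inp : seq int) :
    cmd -> seq int -> seq int -> nat -> Prop :=
  | exec_Skip mem : exec w inp Skip mem mem 1
  | exec_Store ea ev mem a v mem' :
      eval w inp mem ea = Some a -> eval w inp mem ev = Some v ->
      update mem a v = Some mem' ->
      exec w inp (Store ea ev) mem mem' (cost ea + cost ev).+1
  | exec_Seq c1 c2 mem mem1 mem2 t1 t2 :
      exec w inp c1 mem mem1 t1 -> exec w inp c2 mem1 mem2 t2 ->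
      exec w inp (Seq c1 c2) mem mem2 (t1 + t2)
  | exec_If e c1 c2 mem x mem' t :
      eval w inp mem e = Some x ->
      exec w inp (if x != 0 then c1 else c2) mem mem' t ->
      exec w inp (If e c1 c2) mem mem' (cost e + t).+1
  | exec_WhileF e c mem :
      eval w inp mem e = Some 0 ->
      exec w inp (While e c) mem mem (cost e).+1
  | exec_WhileT e c mem x mem1 mem2 t1 t2 :
      eval w inp mem e = Some x -> x != 0 ->
      exec w inp c mem mem1 t1 -> exec w inp (While e c) mem1 mem2 t2 ->
      exec w inp (While e c) mem mem2 (cost e + t1 + t2).+1.

Lemma exec_det w inp c mem mem1 t1 mem2 t2 :
  exec w inp c mem mem1 t1 -> exec w inp c mem mem2 t2 ->
  mem1 = mem2 /\ t1 = t2.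
Proof.
move=> run1; elim: run1 mem2 t2 => {c mem mem1 t1}.
- by move=> mem mem2 t2 run2; inversion run2.
- move=> ea ev mem a v mem' Ha Hv Hu mem2 t2 run2; inversion run2; subst.
  by split=> //; congruence.
- move=> c1 c2 mem m1 m2 t1 t2 _ IH1 _ IH2 mem2 t run2.
  inversion run2 as [| |? ? ? ? ? ? ? r1 r2| | |]; subst.
  by have [? ?] := IH1 _ _ r1; subst; have [? ?] := IH2 _ _ r2; subst.
- move=> e c1 c2 mem x mem' t Hx _ IH mem2 t2 run2.
  inversion run2 as [| | |? ? ? ? y ? ? Hy r| |]; subst.
  have ? : x = y by congruence.
  by subst; have [? ?] := IH _ _ r; subst.
- move=> e c mem He mem2 t2 run2.
  inversion run2 as [| | | | |? ? ? y ? ? ? ? Hy yn0]; subst=> //.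
  by move: yn0; rewrite (_ : y = 0) ?eqxx //; congruence.
- move=> e c mem x m1 m2 t1 t2 Hx xn0 _ IH1 _ IH2 mem2 t run2.
  inversion run2 as [| | | |? ? ? H0|? ? ? y ? ? ? ? Hy yn0 r1 r2]; subst.
    by move: xn0; rewrite (_ : x = 0) ?eqxx //; congruence.
  by have [? ?] := IH1 _ _ r1; subst; have [? ?] := IH2 _ _ r2; subst.
Qed.

(* Node [u] is represented by [enum_rank u] < n.  The input is n, m, followed by
   source, target and weight of each edge, in the order of the list [es]. *)
Definition input_words (G : wgraph) (es : seq (node G * node G)) : seq int :=
  [:: Posz #|node G|, Posz (size es) &
     flatten [seq [:: Posz (enum_rank e.1); Posz (enum_rank e.2); wt e]
             | e <- es]].

Definition max_weight (G : wgraph) : nat := \max_(e in edge G) `|wt e|%N.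

(* Largest absolute value held by a machine word of O(log (n + W)) bits, where W
   is the largest absolute value of an edge weight. *)
Definition word_bound (G : wgraph) (c : nat) : nat :=
  ((#|node G| + max_weight G + 2) ^ c)%N.

(* Finite credits are non-positive, so the word 1 is free to represent -oo. *)
Definition output_word (x : option int) : int := odflt 1 x.

(* Main.v *)
Require Import Defs.
From mathcomp Require Import all_boot all_order all_algebra.
From mathcomp Require Import zify.

(** A non-positive cycle contains a node of credit 0. As long as such a cycle
    survives, Bellman-Ford from all nodes (value 0 everywhere), with the weight
    [wt e] replaced by [(n + 1) * wt e - 1] so that non-positive cycles become
    negative, still improves some value in round n. The walk behind that
    improvement has non-positive prefixes, since otherwise it would pay to start
    later, and it repeats a node around a negative cycle. Hence its source has
    credit 0: this node is marked, its outgoing edges are dropped, and the search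
    is repeated, at most k times in total. When no improvement occurs any more,
    all cycles outside the marked nodes are positive. Then every infinite path of
    bounded weight reaches a marked node, a best such path is simple, and n
    rounds of relaxation of [E(u) = min(0, max_v (E(v) - wt(u, v)))] from the
    marked nodes compute all credits. *)

Set Implicit Arguments.
Unset Strict Implicit.
Unset Printing Implicit Defensive.

Import Order.TTheory GRing.Theory Num.Theory.
Local Open Scope ring_scope.

(** * Walks and feasibility *)

Section Walks.
Variables (T : finType) (c : T * T -> int).
Implicit Types (q : nat -> T).

Definition walk_weight q l : int := \sum_(i < l) c (q i, q i.+1).

Lemma walk_weight0 q : walk_weight q 0 = 0.
Proof. by rewrite /walk_weight big_ord0. Qed.

Lemma walk_weightS q l :
  walk_weight q l.+1 = walk_weight q l + c (q l, q l.+1).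
Proof. by rewrite /walk_weight big_ord_recr. Qed.

Lemma eq_walk_weight q q' l :
  (forall i, (i <= l)%N -> q i = q' i) -> walk_weight q l = walk_weight q' l.
Proof.
move=> eqq; apply: eq_bigr => i _.
by rewrite !eqq // ltnW.
Qed.

Definition extend q l v : nat -> T := fun i => if (i <= l)%N then q i else v.

Lemma extend_le q l v i : (i <= l)%N -> extend q l v i = q i.
Proof. by rewrite /extend => ->. Qed.

Lemma extend_last q l v : extend q l v l.+1 = v.
Proof. by rewrite /extend ltnn. Qed.

Lemma walk_weight_extend_le q l v i :
  (i <= l)%N -> walk_weight (extend q l v) i = walk_weight q i.
Proof.
move=> il; apply: eq_walk_weight => t ti.
by rewrite extend_le //; apply: leq_trans il.
Qed.

Lemma walk_weight_extend q l v :
  walk_weight (extend q l v) l.+1 = walk_weight q l + c (q l, v).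
Proof.
by rewrite walk_weightS walk_weight_extend_le // extend_last extend_le.
Qed.

(** Cuts out the [d] steps after position [i]; a walk remains when [q i = q (i + d)]. *)
Definition shortcut q i d : nat -> T :=
  fun t => if (t <= i)%N then q t else q (t + d)%N.

Lemma shortcut_le q i d t : (t <= i)%N -> shortcut q i d t = q t.
Proof. by rewrite /shortcut => ->. Qed.

Lemma shortcut_add q i d t :
  q i = q (i + d)%N -> shortcut q i d (i + t) = q (i + d + t)%N.
Proof.
move=> eqq; rewrite /shortcut; case: t => [|t]; first by rewrite !addn0 leqnn.
by rewrite ifF; [congr q; lia | lia].
Qed.

Lemma walk_weight_shortcut_le q i d t :
  (t <= i)%N -> walk_weight (shortcut q i d) t = walk_weight q t.
Proof.
move=> ti; apply: eq_walk_weight => s st.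
by rewrite shortcut_le //; apply: leq_trans ti.
Qed.

Lemma walk_weight_shortcut_add q i d t : q i = q (i + d)%N ->
  walk_weight (shortcut q i d) (i + t) =
  walk_weight q (i + d + t) - (walk_weight q (i + d) - walk_weight q i).
Proof.
move=> eqq; elim: t => [|t IH].
  by rewrite !addn0 walk_weight_shortcut_le //; lia.
rewrite !addnS !walk_weightS IH -addnS !shortcut_add // addnS; lia.
Qed.

Lemma walk_repeat q : exists i j, [/\ (i < j)%N, (j <= #|T|)%N & q i = q j].
Proof.
pose f (i : 'I_#|T|.+1) := q i.
have /injectivePn[i [j ij qij]] : ~~ injectiveb f.
  apply/negP => /injectiveP/leq_card; by rewrite card_ord ltnn.
have [ij'|ij'|/val_inj ij'] := ltngtP i j; last by rewrite ij' eqxx in ij.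
  by exists i, j; split=> //; rewrite -ltnS.
by exists j, i; split=> //; rewrite -ltnS.
Qed.

End Walks.

Section Feasibility.
Variable G : wgraph.
Implicit Types (q : nat -> node G) (u v : node G).

(** Prepend the edge to a path for [v]: the empty prefix needs [x <= 0], and any longer one is a
    prefix from [v] shifted by the edge weight. *)
Lemma feasible_edge u v x y : (u, v) \in edge G -> feasible v y ->
  x <= 0 -> x + wt (u, v) <= y -> feasible u x.
Proof.
move=> uv [p [p0 pp hp]] x0 xy.
exists (fun i => if i is i'.+1 then p i' else u); split=> //.
  by case=> [|i] /=; rewrite ?p0.
case=> [|j]; first by rewrite /prefix_weight big_ord0 addr0.
rewrite /prefix_weight big_ord_recl /= p0.
apply: le_trans (hp j); rewrite addrA /prefix_weight.
under eq_bigr => i _ do rewrite /bump /= ?add0n.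
by rewrite lerD2r.
Qed.

(* Follow the walk, then run around the cycle between [i] and [j] forever. *)
Lemma feasible_lasso q i j : (i < j)%N -> q i = q j ->
  (forall t, (t < j)%N -> (q t, q t.+1) \in edge G) ->
  (forall t, (t < j)%N -> walk_weight (@wt G) q t <= 0) ->
  walk_weight (@wt G) q j <= walk_weight (@wt G) q i ->
  feasible (q 0%N) 0.
Proof.
move=> ij qij edges pre0 cyc.
pose next t := if (t.+1 < j)%N then t.+1 else i.
have qnext t : (t < j)%N -> q (next t) = q t.+1.
  rewrite /next; case: ifPn => // tj tj'.
  by rewrite qij; congr q; lia.
have ltnext k : (iter k next 0 < j)%N.
  elim: k => [|k IH] /=; first lia.
  by rewrite /next; case: ifP.
exists (fun k => q (iter k next 0%N)); split=> //.
  by move=> k /=; rewrite qnext //; apply: edges.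
move=> k; rewrite add0r.
(* The weight of [k] steps is at most that of [q] up to the current position: a jump from [j] back
   to [i] only raises this bound, the cycle being non-positive. *)
apply: le_trans (pre0 _ (ltnext k)).
elim: k => [|k IH]; first by rewrite /prefix_weight big_ord0 walk_weight0.
rewrite /prefix_weight big_ord_recr /= qnext //.
apply: (@le_trans _ _ (walk_weight (@wt G) q (iter k next 0).+1)).
  by rewrite walk_weightS lerD2r.
move: (ltnext k); move: (iter k next 0%N) => t tj.
rewrite /next; case: ifPn => // nlt.
by rewrite (_ : t.+1 = j) //; lia.
Qed.

Lemma credit0 u : feasible u 0 -> credit u = Some 0.
Proof.
by move=> fu; apply/credit_SomeP; split=> // y /feasible_le0.
Qed.

Lemma wt_le (e : node G * node G) : e \in edge G -> (`|wt e| <= max_weight G)%N.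
Proof. exact: (leq_bigmax_cond (F := fun e => `|wt e|%N)). Qed.

End Feasibility.

(** * Marking nodes of credit 0 *)

Section BellmanFord.
Variable G : wgraph.
Local Notation V := (node G).
Local Notation n := #|V|.
Implicit Types (o x y : V -> int) (s z : V -> V) (q : nat -> V).

(* For a non-empty walk of length at most n, the scaled weight is negative if
   and only if the weight is non-positive. *)
Definition scaled (e : V * V) : int := n.+1%:Z * wt e - 1.

Lemma walk_weight_scaled q l :
  walk_weight scaled q l = n.+1%:Z * walk_weight (@wt G) q l - l%:Z.
Proof.
elim: l => [|l IH]; first by rewrite !walk_weight0 mulr0 subr0.
rewrite !walk_weightS IH /scaled mulrDr; lia.
Qed.

(* [o u = 0] marks the nodes already known to have credit 0; their outgoing
   edges are ignored. *)
Definition active_walk o q l :=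
  forall i, (i < l)%N -> (q i, q i.+1) \in edge G /\ o (q i) != 0.

(** The Bellman-Ford invariant after [r] rounds. The source [s v] is tracked because it is the node
    to be marked, and the prefix condition because it is what gives this node credit 0. *)
Record shortest_walks o r x s := ShortestWalks {
  sw_walk : forall v, exists q l,
    [/\ (l <= r)%N, active_walk o q l, q 0%N = s v, q l = v &
      walk_weight scaled q l = x v /\
      forall i, (i <= l)%N -> walk_weight scaled q i <= 0];
  sw_min : forall q l, (l <= r)%N -> active_walk o q l ->
    x (q l) <= walk_weight scaled q l }.

Lemma shortest_walks0 o : shortest_walks o 0 (fun=> 0) id.
Proof.
split=> [v|q l]; last by rewrite leqn0 => /eqP-> _; rewrite walk_weight0.
exists (fun=> v), 0%N; split=> //; rewrite walk_weight0; split=> // i.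
by rewrite leqn0 => /eqP ->; rewrite walk_weight0.
Qed.

Lemma sw_le0 o r x s v : shortest_walks o r x s -> x v <= 0.
Proof.
by case=> /(_ v) [q [l [_ _ _ _ [<- le0]]]] _; apply: le0.
Qed.

Lemma active_walk_extend o q l v : active_walk o q l ->
  (q l, v) \in edge G -> o (q l) != 0 -> active_walk o (extend q l v) l.+1.
Proof.
move=> aw ev ov i; rewrite ltnS leq_eqVlt => /orP[/eqP->|il].
  by rewrite extend_last extend_le.
by rewrite !extend_le ?(ltnW il) //; apply: aw.
Qed.

Lemma active_walk_shortcut o q i d l : q i = q (i + d)%N ->
  active_walk o q (i + d + l) -> active_walk o (shortcut q i d) (i + l).
Proof.
move=> eqq aw t tl; have [it|ti] := leqP i t.
  rewrite -(subnKC it) -addnS !shortcut_add // addnS; apply: aw; lia.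
rewrite !shortcut_le ?(ltnW ti) //; apply: aw; lia.
Qed.

(* The state in the middle of a round that turns [x], [s] into [y], [z], when
   the edges in [l] have been relaxed. *)
Record relaxed o x s (l : seq (V * V)) y z (f : option V) := Relaxed {
  rx_le : forall v, y v <= x v;
  rx_edge : forall e, e \in l -> o e.1 != 0 -> y e.2 <= x e.1 + scaled e;
  rx_from : forall v, (y v = x v /\ z v = s v) \/ exists e,
    [/\ e \in edge G, e.2 = v, o e.1 != 0, y v = x e.1 + scaled e & z v = s e.1];
  rx_found : if f is Some a then
      exists e, [/\ e \in edge G, o e.1 != 0, x e.1 + scaled e < x e.2
                  & a = s e.1]
    else forall v, y v = x v }.

Definition upd (A : Type) (g : V -> A) v a : V -> A :=
  fun u => if u == v then a else g u.

Lemma relaxed_nil o x s : relaxed o x s [::] x s None.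
Proof. by split=> // v; left. Qed.

Lemma relaxed_update o x s l y z f e : e \in edge G ->
  relaxed o x s l y z f -> o e.1 != 0 -> x e.1 + scaled e < y e.2 ->
  relaxed o x s (rcons l e) (upd y e.2 (x e.1 + scaled e))
    (upd z e.2 (s e.1)) (Some (s e.1)).
Proof.
move=> eE [yx ye yf ff] oe lt; split.
- move=> v; rewrite /upd; case: eqP => [->|_] //.
  by apply: ltW (lt_le_trans lt _).
- move=> e'; rewrite mem_rcons inE /upd => /orP[/eqP->|e'l] oe'.
    by rewrite eqxx.
  case: eqP => [e2|_]; last exact: ye.
  apply: le_trans (ltW lt) _; rewrite -e2; exact: ye.
- move=> v; rewrite /upd; case: eqP => [->|_]; last exact: yf.
  by right; exists e.
- exists e; split=> //; exact: lt_le_trans lt _.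
Qed.

Lemma relaxed_skip o x s l y z f e :
  relaxed o x s l y z f -> ~~ ((o e.1 != 0) && (x e.1 + scaled e < y e.2)) ->
  relaxed o x s (rcons l e) y z f.
Proof.
case=> yx ye yf ff nlt; split=> // e'.
rewrite mem_rcons inE => /orP[/eqP->|e'l] oe; last exact: ye.
by move: nlt; rewrite oe /= -leNgt.
Qed.

(** An attaining walk is kept or extended by a relaxed edge; its total weight stays non-positive as
    values only decrease from 0. For minimality, the last edge of a walk of length [r.+1] has been
    relaxed, as [l] covers all edges. *)
Lemma shortest_walksS o r x s l y z f : {subset edge G <= l} ->
  shortest_walks o r x s -> relaxed o x s l y z f ->
  shortest_walks o r.+1 y z.
Proof.
move=> El sw [yx ye yf _]; have [swx minx] := sw; split.
  move=> v; case: (yf v) => [[-> ->]|[e [eE ev oe yv zv]]].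
    have [q [k [kr aw q0 qk xq]]] := swx v.
    by exists q, k; split=> //; apply: leqW.
  have [q [k [kr aw q0 qk [xq qle0]]]] := swx e.1.
  have eqE : (q k, v) = e by rewrite qk -ev; case: (e).
  exists (extend q k v), k.+1; rewrite zv; split=> //.
  - by apply: active_walk_extend; rewrite ?eqE ?qk.
  - by rewrite extend_last.
  - rewrite walk_weight_extend eqE xq yv; split=> // i.
    rewrite leq_eqVlt => /orP[/eqP->|ik].
      rewrite walk_weight_extend eqE xq.
      by rewrite -yv; apply: le_trans (yx v) (sw_le0 v sw).
    by rewrite walk_weight_extend_le //; apply: qle0.
move=> q k; rewrite leq_eqVlt => /orP[/eqP->|kr] aw; last first.
  exact: le_trans (yx _) (minx _ _ kr aw).
rewrite walk_weightS; have [eE oe] := aw r (ltnSn r).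
apply: le_trans (ye _ (El _ eE) oe) _; rewrite lerD2r.
by apply: minx => // i ir; apply: aw; apply: ltnW.
Qed.

(* An improvement in the last round comes from a walk of length n, which must
   contain a negative cycle; all its prefixes are non-positive. *)
Lemma found_credit0 o r x s l y z a : n = r.+1 ->
  shortest_walks o r x s -> relaxed o x s l y z (Some a) ->
  feasible a 0 /\ o a != 0.
Proof.
move=> nr sw [_ _ _ [e [eE oe lt ->]]]; have [swx minx] := sw.
have [q [k [kr aw q0 qk [xq qle0]]]] := swx e.1.
have eqE : (q k, e.2) = e by rewrite qk; case: (e).
have awq := active_walk_extend (v := e.2) aw; move: awq.
rewrite qk -surjective_pairing => /(_ eE oe) awq.
set q' := extend q k e.2 in awq.
have wq' : walk_weight scaled q' k.+1 = x e.1 + scaled e.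
  by rewrite walk_weight_extend eqE xq.
have q'k : q' k.+1 = e.2 by rewrite /q' extend_last.
have q'0 : q' 0%N = s e.1 by rewrite /q' extend_le.
(* A shorter walk would extend to one of length at most [r], so [x e.2] would already be as small as
   the improved value. *)
have kE : k = r.
  apply/eqP; rewrite eqn_leq kr leqNgt; apply/negP => kr'.
  by have := minx _ _ kr' awq; rewrite wq' q'k leNgt lt.
subst k.
have le0 i : (i <= r.+1)%N -> walk_weight scaled q' i <= 0.
  rewrite leq_eqVlt => /orP[/eqP->|ir].
    rewrite wq'; exact: le_trans (ltW lt) (sw_le0 _ sw).
  by rewrite walk_weight_extend_le //; apply: qle0.
have [i [j [ij jn qij]]] := walk_repeat q'.
rewrite nr in jn.
(* Cutting out a cycle of non-negative scaled weight would leave a walk to [e.2] of length at most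
   [r], no heavier than the improvement, against the minimality of [x e.2]. *)
have cyc : walk_weight scaled q' j < walk_weight scaled q' i.
  rewrite ltNge; apply/negP => ge.
  have qij' : q' i = q' (i + (j - i))%N by rewrite subnKC // ltnW.
  have jl : (i + (j - i) + (r.+1 - j) = r.+1)%N by lia.
  have awq'' : active_walk o (shortcut q' i (j - i)) (i + (r.+1 - j)).
    by apply: active_walk_shortcut; rewrite ?jl.
  have lr : (i + (r.+1 - j) <= r)%N by lia.
  have := minx _ _ lr awq''.
  rewrite shortcut_add // walk_weight_shortcut_add // jl q'k wq'.
  rewrite (_ : i + (j - i) = j)%N; lia.
(* For an integer [P], [(n + 1) * P <= t <= n] forces [P <= 0]. The same rounding later makes the
   cycle non-positive. *)
have unscale t : (t <= r.+1)%N -> walk_weight (@wt G) q' t <= 0.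
  move=> tr; have := le0 t tr; rewrite walk_weight_scaled nr.
  by move: (walk_weight _ _ _) => P; nia.
rewrite -q'0; split; last by case: (awq 0%N).
apply: (@feasible_lasso _ q' i j) => //.
- by move=> t tj; case: (awq t) => //; lia.
- by move=> t tj; apply: unscale; lia.
- move: cyc; rewrite !walk_weight_scaled nr.
  move: (walk_weight _ _ i) (walk_weight _ _ j) => P P'; nia.
Qed.

(** A feasible potential for the scaled weights: it certifies that cycles of unmarked nodes have
    non-negative scaled weight, hence positive weight. *)
Definition potential o x := forall e, e \in edge G -> o e.1 != 0 ->
  x e.2 <= x e.1 + scaled e.

Lemma not_found_potential o x s l y z : {subset edge G <= l} ->
  relaxed o x s l y z None -> potential o x.
Proof.
move=> El [_ ye _ yx] e eE oe; rewrite -yx; apply: ye => //; exact: El.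
Qed.

(** Telescoping; the term [d] collects the [-1] of each scaled weight. On a closed walk the
    potentials cancel, so its weight is positive when [d > 0]. *)
Lemma potential_walk o x q i d : potential o x ->
  (forall t, (i <= t < i + d)%N -> (q t, q t.+1) \in edge G /\ o (q t) != 0) ->
  x (q (i + d)%N) + d%:Z - x (q i) <= n.+1%:Z *
    (walk_weight (@wt G) q (i + d) - walk_weight (@wt G) q i).
Proof.
move=> pot; elim: d => [|d IH] qe; first by rewrite addn0; lia.
have {}IH := IH (fun t _ => qe t ltac:(lia)).
have [eE oe] := qe (i + d)%N ltac:(lia).
have := pot _ eE oe; rewrite addnS walk_weightS /= /scaled.
move: IH; set P := walk_weight _ _ (i + d); set Q := walk_weight _ _ _.
move: (n.+1%:Z) (wt _) (x (q (i+d).+1)) (x (q (i+d)%N)) => N w a b; nia.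
Qed.

(** The potential is bounded, so along unmarked nodes the prefix weight grows at least linearly and
    finally exceeds [- b]. *)
Lemma bounded_hits o x q b : potential o x -> infinite_path q ->
  (forall j, b + prefix_weight q j <= 0) -> exists j, o (q j) == 0.
Proof.
move=> pot qp qb.
have [mn hmn] : exists B : nat, forall v, `|x v| <= B%:Z.
  exists (\max_v `|x v|)%N => v; rewrite -abszE lez_nat.
  exact: (leq_bigmax v).
(* The potential difference accounts for at most [2 * mn] steps and the weight bound for
   [(n + 1) * |b|]; one more step is contradictory. *)
pose D := (mn.*2 + n.+1 * `|b| + 1)%N.
case: (boolP [exists j : 'I_D, o (q j) == 0]) => [/existsP[j oj]|/existsPn no].
  by exists j.
exfalso.
have := @potential_walk o x q 0 D pot; rewrite add0n walk_weight0 subr0.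
move=> /(_ (fun t tD => conj (qp t) (no (Ordinal tD)))).
have := qb D; rewrite -[prefix_weight q D]/(walk_weight (@wt G) q D).
have := hmn (q D); have := hmn (q 0%N).
move: (walk_weight _ _ _) (x (q D)) (x (q 0%N)) => P a a' h1 h2 h3.
rewrite /D; nia.
Qed.


(* Removing cycles outside the marked nodes, which have positive weight, only
   lowers the prefix weights. *)
Lemma short_walk_to_marked o x q l b : potential o x ->
  active_walk o q l -> o (q l) = 0 ->
  (forall i, (i <= l)%N -> b + walk_weight (@wt G) q i <= 0) ->
  exists q' l', [/\ (l' <= n)%N, q' 0%N = q 0%N, active_walk o q' l',
    o (q' l') = 0 & forall i, (i <= l')%N -> b + walk_weight (@wt G) q' i <= 0].
Proof.
move=> pot; have [k] := ubnP l; elim: k l q => // k IH l q lk aw ol pre.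
have [ln|nl] := leqP l n; first by exists q, l.
have [i [j [ij jn qij]]] := walk_repeat q.
have qij' : q i = q (i + (j - i))%N by rewrite subnKC // ltnW.
have jl : (i + (j - i) + (l - j) = l)%N by lia.
have aw' : active_walk o (shortcut q i (j - i)) (i + (l - j)).
  by apply: active_walk_shortcut; rewrite ?jl.
have := @potential_walk o x q i (j - i) pot _.
rewrite subnKC ?(ltnW ij) // qij => /(_ (fun t tij => aw t ltac:(lia))) cyc.
have {cyc} pos : walk_weight (@wt G) q i <= walk_weight (@wt G) q j.
  move: cyc; move: (walk_weight _ _ _) (walk_weight _ _ _) => P P'; nia.
have [q' [l' [l'n q'0 aw'' ol' pre']]] :
    exists q' l', [/\ (l' <= n)%N, q' 0%N = shortcut q i (j - i) 0,
      active_walk o q' l', o (q' l') = 0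
      & forall i, (i <= l')%N -> b + walk_weight (@wt G) q' i <= 0].
  apply: (IH (i + (l - j))%N) => //; first lia.
    by rewrite shortcut_add // jl.
  move=> t tl; have [it|ti] := leqP i t; last first.
    by rewrite walk_weight_shortcut_le ?(ltnW ti) //; apply: pre; lia.
  rewrite -(subnKC it) walk_weight_shortcut_add // (subnKC (ltnW ij)).
  have := pre (j + (t - i))%N ltac:(lia); lia.
by exists q', l'; split=> //; rewrite q'0 shortcut_le.
Qed.

End BellmanFord.

(** * Credits from the marked nodes *)

Section Relaxation.
Variable G : wgraph.
Local Notation V := (node G).
Local Notation n := #|V|.
Implicit Types (o cur : V -> int) (u v : V) (e : V * V) (q : nat -> V).

(** The upper bound excludes the value 1, which encodes -oo. *)
Definition achieves o u (b : int) := b <= o u <= 0.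

Definition sound o := forall v, o v = 1 \/ feasible v (o v).

Definition candidate o e : int := Num.min (o e.2 - wt e) 0.

(** The code 1 of -oo lies numerically above all credits and is tested apart: at the target it
    blocks the edge, at the source any candidate improves on it. *)
Definition improves o e :=
  (o e.2 < 1) && ((0 < o e.1) || (o e.1 < candidate o e)).

(** Updates are made in place, so an edge may read values already improved in the same round.
    Comparing with the state [o] at the start of the round suffices, as credits only improve. *)
Record relaxed_credit o (l : seq (V * V)) cur := RelaxedCredit {
  rc_mono : forall u b, achieves o u b -> achieves cur u b;
  rc_edge : forall e b, e \in l -> b <= 0 -> achieves o e.2 (b + wt e) ->
    achieves cur e.1 b }.

Lemma relaxed_credit_nil o : relaxed_credit o [::] o.
Proof. by []. Qed.

Lemma relaxed_credit_update o l cur e : relaxed_credit o l cur ->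
  improves cur e ->
  relaxed_credit o (rcons l e) (upd cur e.1 (candidate cur e)).
Proof.
move=> [mono edges] /andP[ev eu].
have mono' u b : achieves cur u b ->
    achieves (upd cur e.1 (candidate cur e)) u b.
  rewrite /achieves /upd; case: eqP => [->|_] //.
  by move: eu; rewrite /candidate; lia.
split=> [u b /mono/mono'|e' b] //.
rewrite mem_rcons inE => /orP[/eqP->|e'l] b0 ach; last by apply/mono'/edges.
by move/mono: ach; rewrite /achieves /upd eqxx /candidate; lia.
Qed.

Lemma relaxed_credit_skip o l cur e : relaxed_credit o l cur ->
  ~~ improves cur e -> relaxed_credit o (rcons l e) cur.
Proof.
move=> [mono edges] nimp; split=> // e' b.
rewrite mem_rcons inE => /orP[/eqP->|e'l] b0 ach; last exact: edges.
by move/mono: ach; move: nimp; rewrite /improves /achieves /candidate; lia.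
Qed.

Lemma sound_update o e : e \in edge G -> sound o -> improves o e ->
  sound (upd o e.1 (candidate o e)).
Proof.
move=> eE so /andP[ev _] v; rewrite /upd; case: eqP => [->|_]; last exact: so.
right; case: (so e.2) => [ev1|fe]; first by rewrite ev1 in ev.
apply: feasible_edge fe _ _; first by rewrite -surjective_pairing.
  by rewrite /candidate; lia.
by rewrite -surjective_pairing /candidate; lia.
Qed.

Lemma candidate_bound o (B : nat) e : e \in edge G ->
  (forall v, (`|o v| <= B)%N) -> (`|candidate o e| <= B + max_weight G)%N.
Proof.
move=> eE oB; have := oB e.2; have := wt_le eE.
rewrite /candidate; lia.
Qed.

Variable marked : V -> int.

(** The invariant after [r] rounds, where [marked] remains the state from before the first of
    them. *)
Definition complete_upto r o := forall q l b, (l <= r)%N ->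
  active_walk marked q l -> marked (q l) = 0 ->
  (forall i, (i <= l)%N -> b + walk_weight (@wt G) q i <= 0) ->
  achieves o (q 0%N) b.

Lemma complete_upto0 : complete_upto 0 marked.
Proof.
move=> q l b; rewrite leqn0 => /eqP-> _ q0 /(_ 0%N (leqnn 0)).
by rewrite walk_weight0 /achieves q0; lia.
Qed.

(** Split off the first edge [e]: the remaining walk has at most [r] edges and sustains [b + wt e],
    and relaxing [e] transfers this to the source. *)
Lemma complete_uptoS r o l cur : {subset edge G <= l} ->
  complete_upto r o -> relaxed_credit o l cur -> complete_upto r.+1 cur.
Proof.
move=> El co [mono edges] q [|k] b kr aw ql pre.
  by apply: mono; apply: co aw ql pre.
have [eE _] := aw 0%N (ltn0Sn k).
have b0 : b <= 0 by have := pre 0%N isT; rewrite walk_weight0; lia.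
apply: (edges (q 0%N, q 1%N)) => //=; first exact: El.
apply: (co (fun i => q i.+1) k) => //; first by move=> i ik; apply: aw.
move=> i ik; have := pre i.+1 ik.
by rewrite /walk_weight big_ord_recl addrA.
Qed.

(** Soundness makes [o u] feasible or 1. Conversely, a path for a feasible [b] meets a marked node,
    and its part up to there, once shortened, gives [b <= o u] by completeness. *)
Lemma complete_credit x o : potential marked x -> sound o ->
  complete_upto n o -> forall u, output_word (credit u) = o u.
Proof.
move=> pot so co u.
have ach b : feasible u b -> achieves o u b.
  move=> [p [<- pp pb]].
  have ex : exists j, marked (p j) == 0 by apply: bounded_hits pot pp pb.
  (* Taking the first marked node leaves only unmarked ones before it, as an active walk
     requires. *)
  case: (ex_minnP ex) => l /eqP pl minl.
  have aw : active_walk marked p l.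
    move=> i il; split; first exact: pp.
    by apply/negP => /minl; rewrite leqNgt il.
  have [q [k [kn <- aw' qk pre]]] :=
    short_walk_to_marked pot aw pl (fun i _ => pb i).
  exact: co aw' qk pre.
case: (so u) => [u1|fu].
  rewrite (_ : credit u = None) ?u1 //; apply/credit_NoneP => b /ach.
  by rewrite /achieves u1; lia.
rewrite (_ : credit u = Some (o u)) //; apply/credit_SomeP; split=> // y /ach.
by case/andP.
Qed.

End Relaxation.

(** * The machine *)

Section WeakestPrecondition.
Variables (w : nat) (inp : seq int).

Lemma eval_Const mem x : (`|x| <= w)%N -> eval w inp mem (Const x) = Some x.
Proof. by rewrite /= /word => ->. Qed.

Lemma eval_Bin mem o e1 e2 x y :
  eval w inp mem e1 = Some x -> eval w inp mem e2 = Some y ->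
  (`|eval_binop o x y| <= w)%N ->
  eval w inp mem (Bin o e1 e2) = Some (eval_binop o x y).
Proof. by rewrite /= /word => -> -> ->. Qed.

Lemma eval_Mem mem a i : eval w inp mem a = Some (Posz i) ->
  (i < size mem)%N -> eval w inp mem (Defs.Mem a) = Some (nth 0 mem i).
Proof. by move=> /= -> im /=; rewrite onthE (nth_map 0). Qed.

Lemma eval_Inp mem a i x : eval w inp mem a = Some (Posz i) ->
  onth inp i = Some x -> (`|x| <= w)%N ->
  eval w inp mem (Inp a) = Some x.
Proof. by rewrite /= => -> /= -> /=; rewrite /word => ->. Qed.

(** Total correctness with a time budget: a halting run must exist, and [t] is only an upper bound,
    so budgets can be rounded up. *)
Definition wp c mem (Q : seq int -> Prop) t :=
  exists mem' t', [/\ exec w inp c mem mem' t', (t' <= t)%N & Q mem'].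

Lemma wp_weaken c mem (Q Q' : seq int -> Prop) t t' : (t' <= t)%N ->
  (forall mem', Q' mem' -> Q mem') -> wp c mem Q' t' -> wp c mem Q t.
Proof.
move=> tt QQ [mem' [s [ex st q]]]; exists mem', s; split=> //; last exact: QQ.
exact: leq_trans tt.
Qed.

Lemma wp_Skip mem (Q : seq int -> Prop) t :
  (0 < t)%N -> Q mem -> wp Skip mem Q t.
Proof. by move=> t0 q; exists mem, 1%N; split=> //; constructor. Qed.

Lemma wp_Store ea ev mem a v (Q : seq int -> Prop) t :
  (cost ea + cost ev < t)%N ->
  eval w inp mem ea = Some (Posz a) -> eval w inp mem ev = Some v ->
  (a < size mem)%N -> Q (set_nth 0 mem a v) -> wp (Store ea ev) mem Q t.
Proof.
move=> ct Ha Hv am q; exists (set_nth 0 mem a v), (cost ea + cost ev).+1.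
by split=> //; apply: exec_Store Ha Hv _; rewrite /= am.
Qed.

Lemma wp_Seq t1 t2 c1 c2 mem Q t : (t1 + t2 <= t)%N ->
  wp c1 mem (fun mem' => wp c2 mem' Q t2) t1 -> wp (Seq c1 c2) mem Q t.
Proof.
move=> ct [m1 [s1 [ex1 st1 [m2 [s2 [ex2 st2 q]]]]]].
exists m2, (s1 + s2)%N; split=> //; first exact: exec_Seq ex1 ex2.
by apply: leq_trans ct; apply: leq_add.
Qed.

Lemma wp_If t' e c1 c2 mem x Q t : (cost e + t' < t)%N ->
  eval w inp mem e = Some x -> wp (if x != 0 then c1 else c2) mem Q t' ->
  wp (If e c1 c2) mem Q t.
Proof.
move=> ct ex [m1 [s1 [ex1 st1 q]]].
exists m1, (cost e + s1).+1; split=> //; first exact: exec_If ex ex1.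
by apply: leq_trans ct; rewrite ltnS leq_add2l.
Qed.

Lemma wp_WhileF e c mem (Q : seq int -> Prop) t : (cost e < t)%N ->
  eval w inp mem e = Some 0 -> Q mem -> wp (While e c) mem Q t.
Proof. by exists mem, (cost e).+1; split=> //; apply: exec_WhileF. Qed.

Lemma wp_WhileT t1 t2 e c mem x Q t : (cost e + t1 + t2 < t)%N ->
  eval w inp mem e = Some x -> x != 0 ->
  wp c mem (fun mem' => wp (While e c) mem' Q t2) t1 ->
  wp (While e c) mem Q t.
Proof.
move=> ct ex x0 [m1 [s1 [ex1 st1 [m2 [s2 [ex2 st2 q]]]]]].
exists m2, (cost e + s1 + s2).+1; split=> //; first exact: exec_WhileT ex x0 ex1 ex2.
by apply: leq_trans ct; rewrite ltnS; apply: leq_add; rewrite ?leq_add2l.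
Qed.

Definition var (x : nat) := Defs.Mem (Const (Posz x)).

Definition For (x : nat) (lim : expr) (body : cmd) :=
  Seq (Store (Const (Posz x)) (Const 0))
    (While (Bin Lt (var x) lim)
      (Seq body (Store (Const (Posz x)) (Bin Add (var x) (Const 1))))).

Lemma eval_var mem x : (x <= w)%N -> (x < size mem)%N ->
  eval w inp mem (var x) = Some (nth 0 mem x).
Proof. by move=> xw; apply: eval_Mem; rewrite eval_Const. Qed.

(** The body must leave the counter intact and establish [I i.+1] for the memory after the
    increment. In each iteration, [cost lim + 12] pays for the test and the increment. *)
Lemma wp_For T x lim N body (mem : seq int) (I : nat -> seq int -> Prop)
    (Q : seq int -> Prop) t :
  (N * (T + cost lim + 12) + cost lim + 10 <= t)%N ->
  (x < size mem)%N -> (x <= w)%N -> (N <= w)%N -> (0 < w)%N ->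
  (forall mem, eval w inp mem lim = Some (Posz N)) ->
  (forall i mem, I i mem -> (x < size mem)%N /\ nth 0 mem x = Posz i) ->
  I 0%N (set_nth 0 mem x 0) ->
  (forall i mem, (i < N)%N -> I i mem -> wp body mem (fun mem' =>
     [/\ (x < size mem')%N, nth 0 mem' x = Posz i
       & I i.+1 (set_nth 0 mem' x (Posz i.+1))]) T) ->
  (forall mem, I N mem -> Q mem) ->
  wp (For x lim body) mem Q t.
Proof.
move=> tt xm xw Nw w0 limE Isc I0 Ibody IQ.
have loop d i mem1 : (i + d = N)%N -> I i mem1 ->
    wp (While (Bin Lt (var x) lim)
         (Seq body (Store (Const (Posz x)) (Bin Add (var x) (Const 1)))))
       mem1 Q (d * (T + cost lim + 12) + cost lim + 4).
  have evc i' mem2 : I i' mem2 ->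
      eval w inp mem2 (Bin Lt (var x) lim) = Some (Posz (i' < N)%N).
    move=> /Isc[xm2 x2]; rewrite (eval_Bin (eval_var xw xm2) (limE _)) x2 //=.
    by case: (_ < _) => /=; lia.
  elim: d i mem1 => [|d IH] i mem1 dE Ii.
    rewrite addn0 in dE; apply: wp_WhileF; first by rewrite /=; lia.
      by rewrite (evc _ _ Ii) dE ltnn.
    by apply: IQ; rewrite -dE.
  apply: (@wp_WhileT (T + 6) (d * (T + cost lim + 12) + cost lim + 4) _ _ _ 1) => //.
      by rewrite /=; lia.
    by rewrite (evc _ _ Ii) (_ : (i < N)%N = true) //; lia.
  apply: (@wp_Seq T 6) => //.
  have iN : (i < N)%N by lia.
  apply: wp_weaken (Ibody i mem1 iN Ii) => // mem2 [xm2 x2 I2].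
  apply: (wp_Store (a := x) (v := Posz i.+1)) => //.
  - by rewrite eval_Const.
  - rewrite (@eval_Bin _ Add _ _ (Posz i) 1) ?eval_Const ?eval_var ?x2 //=.
      by congr Some; lia.
    by lia.
  - by apply: (IH i.+1) => //; rewrite addSnnS.
apply: (@wp_Seq 3 (N * (T + cost lim + 12) + cost lim + 4)); first lia.
apply: (wp_Store (a := x) (v := 0)) => //; rewrite ?eval_Const //.
exact: (loop N 0%N).
Qed.

End WeakestPrecondition.

(** * The program *)

Definition node_count := Inp (Const 0).
Definition edge_count := Inp (Const 1).

(* Words 0, 1 and 2 of the memory hold the flag (one plus the source of the last
   improvement, or 0) and the counters of the inner and outer loops. They are
   followed by five arrays of length n: the marks (0 for a marked node, 1 for an
   unmarked one), which become the credits, the values before and after the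
   current Bellman-Ford round, and the sources that go with these values. *)
Definition addr (a : nat) (i : expr) :=
  Bin Add (Bin Add (Const 3) (Bin Mul (Const (Posz a)) node_count)) i.
Definition arr a i := Defs.Mem (addr a i).
Definition field (j : nat) :=
  Inp (Bin Add (Const (Posz j)) (Bin Mul (Const 3) (var 1))).
Definition src := field 2.
Definition dst := field 3.
Definition weight := field 4.

Definition scaled_candidate :=
  Bin Defs.Sub (Bin Add (arr 1 src)
             (Bin Mul (Bin Add node_count (Const 1)) weight)) (Const 1).

Definition relax_edge :=
  If (Bin And (arr 0 src) (Bin Lt scaled_candidate (arr 2 dst)))
    (Seq (Store (addr 2 dst) scaled_candidate)
    (Seq (Store (addr 4 dst) (arr 3 src))
         (Store (Const 0) (Bin Add (arr 3 src) (Const 1)))))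
    Skip.

Definition copy_node :=
  Seq (Store (addr 1 (var 1)) (arr 2 (var 1)))
      (Store (addr 3 (var 1)) (arr 4 (var 1))).

Definition init_node :=
  Seq (Store (addr 1 (var 1)) (Const 0))
  (Seq (Store (addr 2 (var 1)) (Const 0))
  (Seq (Store (addr 3 (var 1)) (var 1))
       (Store (addr 4 (var 1)) (var 1)))).

(** The flag is cleared in every round, so after a search it reports on the last round only. *)
Definition relax_all :=
  Seq (Store (Const 0) (Const 0)) (For 1 edge_count relax_edge).

Definition bellman_ford_round := Seq relax_all (For 1 node_count copy_node).

Definition bellman_ford :=
  Seq (For 1 node_count init_node) (For 2 node_count bellman_ford_round).

Definition mark_found :=
  If (var 0) (Store (addr 0 (Bin Defs.Sub (var 0) (Const 1))) (Const 0)) Skip.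

Definition mark_all :=
  Seq (Store (Const 0) (Const 1)) (While (var 0) (Seq bellman_ford mark_found)).

(** Multiplying the difference by its sign test gives the minimum with 0 without a branch. *)
Definition credit_candidate :=
  Bin Mul (Bin Defs.Sub (arr 0 dst) weight)
    (Bin Lt (Bin Defs.Sub (arr 0 dst) weight) (Const 0)).

Definition relax_credit :=
  If (Bin And (Bin Lt (arr 0 dst) (Const 1))
       (Bin Or (Bin Lt (Const 0) (arr 0 src))
               (Bin Lt (arr 0 src) credit_candidate)))
    (Store (addr 0 src) credit_candidate) Skip.

Definition credit_program :=
  Seq (For 1 node_count (Store (addr 0 (var 1)) (Const 1)))
  (Seq mark_all (For 2 node_count (For 1 edge_count relax_credit))).

(** * Correctness and running time of the program *)

Section Correctness.
Variables (G : wgraph) (es : seq (node G * node G)).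
Hypotheses (G_gt0 : (0 < #|node G|)%N) (esP : perm_eq es (enum (edge G))).
Local Notation V := (node G).
Local Notation n := #|V|.
Local Notation m := #|edge G|.
Local Notation w := (word_bound G 8).
Local Notation inp := (input_words es).
Implicit Types (mem : seq int) (e : V * V) (v : V) (o x y : V -> int) (s z : V -> V).

Lemma mem_es : es =i edge G.
Proof. by move=> e; rewrite (perm_mem esP) mem_enum. Qed.

Lemma size_es : size es = m.
Proof. by rewrite (perm_size esP) cardE. Qed.

(** Every node is the source of an edge. This lets the array passes, of cost [n * n] over all rounds
    of a search, be absorbed into [n * m]. *)
Lemma edge_ge_node : (n <= m)%N.
Proof.
have -> : n = #|[set e.1 | e in edge G]|; last exact: leq_imset_card.
rewrite -cardsT; apply: eq_card => u; rewrite inE; apply/esym/imsetP.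
by have [v uv] := edge_total u; exists (u, v).
Qed.

Lemma edge_le_node : (m <= n * n)%N.
Proof. by rewrite -card_prod max_card. Qed.

(* Every value handled by the program is at most a small multiple of [D]. *)
Definition D := ((n + max_weight G + 2) ^ 4)%N.

(** The exponent 8 leaves a second factor of exponent 4, which is at least [3 ^ 4] because
    [n >= 1]. *)
Lemma D_word : (81 * D <= w)%N.
Proof.
rewrite /word_bound -[8%N]/(4 + 4)%N expnD /D leq_mul2r; apply/orP; right.
by rewrite -[81%N]/(3 ^ 4)%N leq_exp2r //; lia.
Qed.

Lemma D_gt0 : (0 < D)%N.
Proof. by rewrite expn_gt0; lia. Qed.

Lemma D_node : (n <= D)%N.
Proof. rewrite /D !expnS expn0; nia. Qed.

Lemma D_weight : (max_weight G <= D)%N.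
Proof. rewrite /D !expnS expn0; nia. Qed.

Lemma D_edge : (m <= D)%N.
Proof. apply: leq_trans edge_le_node _; rewrite /D !expnS expn0; nia. Qed.

(** Covers the Bellman-Ford values, which are scaled weights of walks with at most [n] edges. *)
Lemma D_scaled : (n.+1 * (n.+1 * max_weight G + 1) <= D)%N.
Proof.
rewrite /D; move: (max_weight G) => W; move: n => k.
have h : (k.+1 * W + 1 <= (k + W + 2) * (k + W + 2))%N by nia.
apply: (@leq_trans ((k + W + 2) * ((k + W + 2) * (k + W + 2)))).
  by apply: leq_mul => //; lia.
rewrite -[4%N]/(3.+1) expnS; rewrite leq_mul2l; apply/orP; right.
by rewrite !expnS expn0 muln1 mulnA; apply: leq_pmulr; lia.
Qed.

(** Covers the credits: each of the [n * m] in-place relaxations may add one edge weight. *)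
Lemma D_rounds : (n * m * max_weight G <= D)%N.
Proof.
rewrite /D !expnS expn0 muln1 -!mulnA; apply: leq_mul; first lia.
have := edge_le_node; move: (max_weight G) => W h.
rewrite mulnA; apply: leq_mul; last lia.
by apply: leq_trans h _; apply: leq_mul; lia.
Qed.

(** * Layout of the input and of the memory *)

Lemma onth_input i e : onth es i = Some e ->
  [/\ onth inp (2 + 3 * i) = Some (Posz (enum_rank e.1)),
      onth inp (3 + 3 * i) = Some (Posz (enum_rank e.2))
    & onth inp (4 + 3 * i) = Some (wt e)].
Proof.
move=> esi; rewrite /input_words.
(* Dropping the two header words lets the induction run over the triples alone. *)
change (let l := flatten
    [seq [:: Posz (enum_rank e.1); Posz (enum_rank e.2); wt e] | e <- es] in
  [/\ onth l (3 * i) = Some (Posz (enum_rank e.1)),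
      onth l (3 * i).+1 = Some (Posz (enum_rank e.2))
    & onth l (3 * i).+2 = Some (wt e)]).
elim: es i esi => [|e' l IH] [|i] // => [[->]|/IH] //.
by rewrite (_ : 3 * i.+1 = (3 * i).+3)%N //; lia.
Qed.

Definition loc a v := (3 + a * n + enum_rank v)%N.

(** Array number and rank are the quotient and remainder of the offset by [n]. *)
Lemma loc_eq a b u v : (loc a u == loc b v) = (a == b) && (u == v).
Proof.
apply/eqP/andP => [|[/eqP-> /eqP->] //].
rewrite /loc -!addnA => /addnI h.
have ab : a = b.
  by have := congr1 (divn^~ n) h; rewrite !divnMDl // !divn_small // !addn0.
split; apply/eqP => //; apply/enum_rank_inj/val_inj.
by move: h; rewrite ab => /addnI.
Qed.

(** Three scalars and five arrays take [3 + 5 * n] words, at most [8 * n] as [n >= 1]. *)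
Lemma loc_lt mem a v : size mem = (8 * n)%N -> (a <= 4)%N -> (loc a v < size mem)%N.
Proof.
move=> -> a4; have : (enum_rank v < n)%N := ltn_ord _.
have := leq_mul a4 (leqnn n); rewrite /loc; lia.
Qed.

Lemma eval_node_count mem : eval w inp mem node_count = Some (Posz n).
Proof.
have := D_word; have := D_node; have := D_gt0 => *.
by apply: (eval_Inp (i := 0)); rewrite ?eval_Const //; lia.
Qed.

Lemma eval_edge_count mem : eval w inp mem edge_count = Some (Posz m).
Proof.
have := D_word; have := D_edge; have := D_gt0 => *.
have i1 : onth inp 1 = Some (Posz m) by rewrite -size_es.
by apply: (eval_Inp _ i1); rewrite ?eval_Const ?absz_nat //; lia.
Qed.

Lemma eval_addr mem a i v : (a <= 4)%N ->
  eval w inp mem i = Some (Posz (enum_rank v)) ->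
  eval w inp mem (addr a i) = Some (Posz (loc a v)).
Proof.
have := D_word; have := D_node; have := D_gt0 => *.
have : (enum_rank v < n)%N := ltn_ord _; have : (a * n <= 4 * n)%N by exact: leq_mul.
have -> : Posz (loc a v) = eval_binop Add
    (eval_binop Add 3 (eval_binop Mul (Posz a) (Posz n))) (Posz (enum_rank v)).
  by rewrite /eval_binop /loc; lia.
move=> *; repeat apply: eval_Bin => //; rewrite ?eval_Const ?eval_node_count //.
all: rewrite /eval_binop; lia.
Qed.

Lemma eval_arr mem a i v : size mem = (8 * n)%N -> (a <= 4)%N ->
  eval w inp mem i = Some (Posz (enum_rank v)) ->
  eval w inp mem (arr a i) = Some (nth 0 mem (loc a v)).
Proof.
move=> sm a4 ei; apply: eval_Mem; first exact: eval_addr.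
exact: loc_lt.
Qed.

Lemma eval_scalar mem k : size mem = (8 * n)%N -> (k <= 2)%N ->
  eval w inp mem (var k) = Some (nth 0 mem k).
Proof.
move=> sm k2; have := D_word; have := D_gt0 => *.
by apply: eval_var; rewrite ?sm; lia.
Qed.

Lemma eval_edge mem i e : size mem = (8 * n)%N -> nth 0 mem 1 = Posz i ->
  onth es i = Some e ->
  [/\ eval w inp mem src = Some (Posz (enum_rank e.1)),
      eval w inp mem dst = Some (Posz (enum_rank e.2))
    & eval w inp mem weight = Some (wt e)].
Proof.
move=> sm m1 esi; have [i1 i2 i3] := onth_input esi.
have im : (i < m)%N by rewrite -size_es -onthTE esi.
have := D_word; have := D_node; have := D_gt0; have := D_edge; have := D_weight => *.
have eE : e \in edge G by rewrite -mem_es; apply/onthP; exists i.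
have ef j : (j <= 4)%N ->
    eval w inp mem (Bin Add (Const (Posz j)) (Bin Mul (Const 3) (var 1))) =
    Some (Posz (j + 3 * i)).
  move=> j4; have -> : Posz (j + 3 * i) =
      eval_binop Add (Posz j) (eval_binop Mul 3 (nth 0 mem 1)).
    by rewrite /= m1; lia.
  by repeat apply: eval_Bin; rewrite ?eval_Const ?eval_scalar //= ?m1; lia.
have : (enum_rank e.1 < n)%N := ltn_ord _.
have : (enum_rank e.2 < n)%N := ltn_ord _ => *.
split; [apply: (eval_Inp (ef 2 isT) i1) | apply: (eval_Inp (ef 3 isT) i2)
       | apply: (eval_Inp (ef 4 isT) i3)].
- by rewrite absz_nat; lia.
- by rewrite absz_nat; lia.
- by have := wt_le eE; lia.
Qed.

Definition flag (f : option V) : int :=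
  if f is Some a then Posz (enum_rank a).+1 else 0.

(** Abstracts the memory into functions on nodes, so that a store into an array becomes [upd] and
    the combinatorial lemmas apply. *)
Record rep mem f (j r : nat) o x y s z : Prop := Rep {
  rep_size : size mem = (8 * n)%N;
  rep_flag : nth 0 mem 0 = flag f;
  rep_inner : nth 0 mem 1 = Posz j;
  rep_outer : nth 0 mem 2 = Posz r;
  rep_o : forall v, nth 0 mem (loc 0 v) = o v;
  rep_x : forall v, nth 0 mem (loc 1 v) = x v;
  rep_y : forall v, nth 0 mem (loc 2 v) = y v;
  rep_s : forall v, nth 0 mem (loc 3 v) = Posz (enum_rank (s v));
  rep_z : forall v, nth 0 mem (loc 4 v) = Posz (enum_rank (z v)) }.

Lemma size_set mem a c : size mem = (8 * n)%N -> (a < size mem)%N ->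
  size (set_nth 0 mem a c) = (8 * n)%N.
Proof. by move=> <- ?; rewrite size_set_nth; apply/maxn_idPr. Qed.

Ltac rep_set :=
  case=> *; split=> *; rewrite ?nth_set_nth /= ?loc_eq ?size_set //=;
  try (by rewrite /upd; case: eqP => // ->);
  try (by rewrite loc_lt); try lia.

Lemma rep_set_flag f' mem f j r o x y s z : rep mem f j r o x y s z ->
  rep (set_nth 0 mem 0 (flag f')) f' j r o x y s z.
Proof. rep_set. Qed.

Lemma rep_set_inner j' mem f j r o x y s z : rep mem f j r o x y s z ->
  rep (set_nth 0 mem 1 (Posz j')) f j' r o x y s z.
Proof. rep_set. Qed.

Lemma rep_set_outer r' mem f j r o x y s z : rep mem f j r o x y s z ->
  rep (set_nth 0 mem 2 (Posz r')) f j r' o x y s z.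
Proof. rep_set. Qed.

Lemma rep_set_o v c mem f j r o x y s z : rep mem f j r o x y s z ->
  rep (set_nth 0 mem (loc 0 v) c) f j r (upd o v c) x y s z.
Proof. rep_set. Qed.

Lemma rep_set_x v c mem f j r o x y s z : rep mem f j r o x y s z ->
  rep (set_nth 0 mem (loc 1 v) c) f j r o (upd x v c) y s z.
Proof. rep_set. Qed.

Lemma rep_set_y v c mem f j r o x y s z : rep mem f j r o x y s z ->
  rep (set_nth 0 mem (loc 2 v) c) f j r o x (upd y v c) s z.
Proof. rep_set. Qed.

Lemma rep_set_s v a mem f j r o x y s z : rep mem f j r o x y s z ->
  rep (set_nth 0 mem (loc 3 v) (Posz (enum_rank a))) f j r o x y (upd s v a) z.
Proof. rep_set. Qed.

Lemma rep_set_z v a mem f j r o x y s z : rep mem f j r o x y s z ->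
  rep (set_nth 0 mem (loc 4 v) (Posz (enum_rank a))) f j r o x y s (upd z v a).
Proof. rep_set. Qed.

(** * Bellman-Ford rounds on the machine *)

Lemma eval_small mem (c : int) :
  (`|c| <= 10)%N -> eval w inp mem (Const c) = Some c.
Proof.
by move=> c10; apply: eval_Const; have := D_word; have := D_gt0; lia.
Qed.

Lemma scaled_bound e : e \in edge G ->
  (`|scaled e| <= n.+1 * max_weight G + 1)%N.
Proof.
move=> /wt_le; rewrite /scaled; move: (wt e) (max_weight G) => a W aW.
have : (`|(n.+1%:Z * a)%R| <= n.+1 * W)%N.
  by rewrite abszM absz_nat leq_mul2l aW orbT.
by move: (n.+1%:Z * a) (n.+1 * W)%N => b c; lia.
Qed.

Lemma shortest_walks_bound o r x s v : (r <= n)%N -> shortest_walks o r x s ->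
  (`|x v| <= D)%N.
Proof.
move=> rn /sw_walk /(_ v) [q [l [lr aw _ _ [<- _]]]].
apply: (@leq_trans (l * (n.+1 * max_weight G + 1))).
  elim: l aw {lr} => [|l IH] aw; first by rewrite walk_weight0.
  have [eE _] := aw l (ltnSn l).
  rewrite walk_weightS mulSn; have := scaled_bound eE.
  have := IH (fun i il => aw i (ltnW il)).
  by move: (walk_weight _ _ _) (_ * _)%N => a b; move: (_ + 1)%N; lia.
by apply: leq_trans D_scaled; rewrite leq_mul2r; apply/orP; right; lia.
Qed.

Lemma eval_scaled_candidate i e mem f r o x y s z :
  rep mem f i r o x y s z -> onth es i = Some e ->
  (forall v, (`|x v| <= D)%N) ->
  eval w inp mem scaled_candidate = Some (x e.1 + scaled e).
Proof.
move=> R esi xD; have [e1 e2 e3] := eval_edge (rep_size R) (rep_inner R) esi.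
have eE : e \in edge G by rewrite -mem_es; apply/onthP; exists i.
have := D_word; have := D_gt0; have := D_node; have := xD e.1.
have sD : (n.+1 * max_weight G + 1 <= D)%N.
  by apply: leq_trans D_scaled; apply: leq_pmull.
have hs := scaled_bound eE => *; rewrite /scaled in hs.
have mE : Posz n + 1 = n.+1%:Z by lia.
have -> : x e.1 + scaled e = eval_binop Defs.Sub (eval_binop Add (x e.1)
    (eval_binop Mul (eval_binop Add (Posz n) 1) (wt e))) 1.
  by rewrite /eval_binop mE /scaled addrA.
have ex : eval w inp mem (arr 1 src) = Some (x e.1).
  by rewrite (eval_arr (rep_size R) _ e1) // (rep_x R).
repeat apply: eval_Bin => //; rewrite ?eval_Const ?eval_node_count //.
all: rewrite /eval_binop ?mE; move: hs sD.
all: move: (n.+1%:Z * wt e) (n.+1 * max_weight G + 1)%N => a b *; lia.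
Qed.

Lemma wp_relax_edge i e mem f r o x y s z :
  rep mem f i r o x y s z -> onth es i = Some e ->
  (forall v, (`|x v| <= D)%N) ->
  wp w inp relax_edge mem (fun mem' =>
    if (o e.1 != 0) && (x e.1 + scaled e < y e.2) then
      rep mem' (Some (s e.1)) i r o x (upd y e.2 (x e.1 + scaled e))
        s (upd z e.2 (s e.1))
    else rep mem' f i r o x y s z) 500.
Proof.
move=> R esi xD; have [e1 e2 _] := eval_edge (rep_size R) (rep_inner R) esi.
have := D_word; have := D_gt0; have := D_node => *.
apply: (@wp_If _ _ 300 _ _ _ _
  (int_of_bool ((o e.1 != 0) && (x e.1 + scaled e < y e.2)))) => //.
  have eo : eval w inp mem (arr 0 src) = Some (o e.1).
    by rewrite (eval_arr (rep_size R) _ e1) // (rep_o R).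
  have ey : eval w inp mem (arr 2 dst) = Some (y e.2).
    by rewrite (eval_arr (rep_size R) _ e2) // (rep_y R).
  have elt := eval_Bin (o := Lt) (eval_scaled_candidate R esi xD) ey.
  rewrite (eval_Bin eo (elt _)) /=.
  - by case: (x e.1 + scaled e < y e.2).
  - by case: (x e.1 + scaled e < y e.2) => /=; lia.
  - by case: (_ && _) => /=; lia.
case: (_ && _) => /=; last exact: wp_Skip.
apply: (@wp_Seq _ _ 100 200) => //.
apply: (wp_Store _ (eval_addr _ e2) (eval_scaled_candidate R esi xD)) => //.
  by apply: loc_lt; rewrite ?(rep_size R).
have {}R := rep_set_y e.2 (x e.1 + scaled e) R.
move: (set_nth _ _ _ _) R => mem1 R.
have [{}e1 {}e2 _] := eval_edge (rep_size R) (rep_inner R) esi.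
have es1 : eval w inp mem1 (arr 3 src) = Some (Posz (enum_rank (s e.1))).
  by rewrite (eval_arr (rep_size R) _ e1) // (rep_s R).
apply: (@wp_Seq _ _ 100 100) => //.
apply: (wp_Store _ (eval_addr _ e2) es1) => //.
  by apply: loc_lt; rewrite ?(rep_size R).
have {es1} {}R := rep_set_z e.2 (s e.1) R.
move: (set_nth _ _ _ _) R => mem2 R.
have [{}e1 {}e2 _] := eval_edge (rep_size R) (rep_inner R) esi.
have es1 : eval w inp mem2 (arr 3 src) = Some (Posz (enum_rank (s e.1))).
  by rewrite (eval_arr (rep_size R) _ e1) // (rep_s R).
have : (enum_rank (s e.1) < n)%N := ltn_ord _ => *.
apply: (wp_Store (a := 0) (v := flag (Some (s e.1)))) => //.
- rewrite (eval_Bin (o := Add) es1 (@eval_small mem2 1 isT)) /eval_binop.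
    by congr Some; rewrite /flag; lia.
  by lia.
- by rewrite (rep_size R); lia.
- exact: rep_set_flag R.
Qed.

(** [wp_For] for an invariant on the abstract state; the counter cell is kept outside [I], and the
    outer counter [r] is preserved. *)
Lemma wp_inner_loop T lim N body r
    (I : nat -> option V -> (V -> int) -> (V -> int) -> (V -> int) ->
         (V -> V) -> (V -> V) -> Prop) mem f j o x y s z t :
  (N * (T + 14) + 12 <= t)%N -> cost lim = 2 -> (N <= D)%N ->
  (forall mem, eval w inp mem lim = Some (Posz N)) ->
  (forall i mem f o x y s z, (i < N)%N -> rep mem f i r o x y s z ->
     I i f o x y s z -> wp w inp body mem (fun mem' => exists f o x y s z,
       rep mem' f i r o x y s z /\ I i.+1 f o x y s z) T) ->
  rep mem f j r o x y s z -> I 0%N f o x y s z ->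
  wp w inp (For 1 lim body) mem (fun mem' => exists f o x y s z,
    rep mem' f N r o x y s z /\ I N f o x y s z) t.
Proof.
move=> tt cl ND limE body_ok R I0; have := D_word; have := D_gt0 => *.
apply: (@wp_For _ _ T 1 lim N _ _ (fun i mem => exists f o x y s z,
    rep mem f i r o x y s z /\ I i f o x y s z)) => //; rewrite ?cl //; try lia.
- by rewrite (rep_size R); lia.
- move=> i mem' [f' [o' [x' [y' [s' [z' [R' _]]]]]]].
  by rewrite (rep_size R') (rep_inner R'); split=> //; lia.
- by exists f, o, x, y, s, z; split=> //; apply: rep_set_inner R.
move=> i mem' iN [f' [o' [x' [y' [s' [z' [R' I']]]]]]].
apply: wp_weaken (body_ok _ _ _ _ _ _ _ _ iN R' I') => //.
move=> mem'' [f2 [o2 [x2 [y2 [s2 [z2 [R2 I2]]]]]]].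
split; [by rewrite (rep_size R2); lia | exact: rep_inner R2 |].
by exists f2, o2, x2, y2, s2, z2; split=> //; apply: rep_set_inner R2.
Qed.

(** The inner counter [j] is existential, because the body may run loops that overwrite it. *)
Lemma wp_outer_loop T body
    (I : nat -> option V -> (V -> int) -> (V -> int) -> (V -> int) ->
         (V -> V) -> (V -> V) -> Prop) mem f j r o x y s z t :
  (n * (T + 14) + 12 <= t)%N ->
  (forall i mem f j o x y s z, (i < n)%N -> rep mem f j i o x y s z ->
     I i f o x y s z -> wp w inp body mem (fun mem' => exists f j o x y s z,
       rep mem' f j i o x y s z /\ I i.+1 f o x y s z) T) ->
  rep mem f j r o x y s z -> I 0%N f o x y s z ->
  wp w inp (For 2 node_count body) mem (fun mem' => exists f j o x y s z,
    rep mem' f j n o x y s z /\ I n f o x y s z) t.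
Proof.
move=> tt body_ok R I0; have := D_word; have := D_gt0; have := D_node => *.
apply: (@wp_For _ _ T 2 node_count n _ _ (fun i mem => exists f j o x y s z,
    rep mem f j i o x y s z /\ I i f o x y s z)) => //; try lia.
- by rewrite -[cost _]/2%N; lia.
- by rewrite (rep_size R); lia.
- exact: eval_node_count.
- move=> i mem' [f' [j' [o' [x' [y' [s' [z' [R' _]]]]]]]].
  by rewrite (rep_size R') (rep_outer R'); split=> //; lia.
- by exists f, j, o, x, y, s, z; split=> //; apply: rep_set_outer R.
move=> i mem' iN [f' [j' [o' [x' [y' [s' [z' [R' I']]]]]]]].
apply: wp_weaken (body_ok _ _ _ _ _ _ _ _ _ iN R' I') => //.
move=> mem'' [f2 [j2 [o2 [x2 [y2 [s2 [z2 [R2 I2]]]]]]]].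
split; [by rewrite (rep_size R2); lia | exact: rep_outer R2 |].
by exists f2, j2, o2, x2, y2, s2, z2; split=> //; apply: rep_set_outer R2.
Qed.

(** Loops over the nodes determine the new arrays only pointwise; this avoids function
    extensionality. *)
Lemma rep_ext mem f j r o x y s z o' x' y' s' z' :
  o =1 o' -> x =1 x' -> y =1 y' -> s =1 s' -> z =1 z' ->
  rep mem f j r o x y s z -> rep mem f j r o' x' y' s' z'.
Proof.
by move=> oo xx yy ss zz [*]; split=> // v; rewrite -?oo -?xx -?yy -?ss -?zz.
Qed.

Lemma nth_edge i : (i < m)%N -> exists e,
  [/\ onth es i = Some e, e \in edge G & take i.+1 es = rcons (take i es) e].
Proof.
rewrite -size_es => im; case ei: (onth es i) => [e|]; last first.
  by have := onthTE es i; rewrite ei im.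
exists e; split=> //; first by rewrite -mem_es; apply/onthP; exists i.
by rewrite (take_nth e im); congr rcons; apply: onth_nth.
Qed.

Lemma nth_node i : (i < n)%N -> exists v, i = enum_rank v :> nat.
Proof. by move=> i_n; exists (enum_val (Ordinal i_n)); rewrite enum_valK. Qed.

Lemma upd_prefix (A : Type) (g : V -> A) (h : V -> A) v i u : i = enum_rank v ->
  (forall u, (enum_rank u < i)%N -> g u = h u) ->
  (enum_rank u < i.+1)%N -> upd g v (h v) u = h u.
Proof.
move=> iv gh; rewrite /upd; case: eqP => [->|uv] // ui; apply: gh.
rewrite ltn_neqAle -ltnS ui andbT; apply/eqP => ui'.
by apply/uv/enum_rank_inj/val_inj; rewrite /= ui' iv.
Qed.

Lemma wp_copy mem f j r o x y s z :
  rep mem f j r o x y s z ->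
  wp w inp (For 1 node_count copy_node) mem (fun mem' =>
    rep mem' f n r o y y z z) (n * 114 + 12).
Proof.
move=> R.
apply: (@wp_weaken _ _ _ _ _ (fun mem' => exists f1 o1 x1 y1 s1 z1,
    rep mem' f1 n r o1 x1 y1 s1 z1 /\
    [/\ f1 = f, o1 = o, y1 = y, z1 = z
      & forall u, (enum_rank u < n)%N -> x1 u = y u /\ s1 u = z u])) (leqnn _) _ _.
  move=> mem' [f1 [o1 [x1 [y1 [s1 [z1 [R1 [fE oE yE zE xs]]]]]]]]; subst f1 o1 y1 z1.
  by apply: rep_ext R1 => // u; case: (xs u (ltn_ord _)).
apply: (@wp_inner_loop 100 node_count n copy_node r
  (fun i f1 o1 x1 y1 s1 z1 => [/\ f1 = f, o1 = o, y1 = y, z1 = z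
      & forall u, (enum_rank u < i)%N -> x1 u = y u /\ s1 u = z u])) R _ => //.
- exact: D_node.
- exact: eval_node_count.
move=> i {}mem f1 o1 x1 y1 s1 z1 i_n R [fE oE yE zE xs]; subst f1 o1 y1 z1.
have [v iv] := nth_node i_n; subst i.
have ev mem' f' r' o' x' y' s' z' : rep mem' f' (enum_rank v) r' o' x' y' s' z' ->
    eval w inp mem' (var 1) = Some (Posz (enum_rank v)).
  by move=> R'; rewrite (eval_scalar (rep_size R')) // (rep_inner R').
apply: (@wp_Seq _ _ 50 50) => //.
apply: (wp_Store (a := loc 1 v) (v := y v)) => //.
- exact: eval_addr (ev _ _ _ _ _ _ _ _ R).
- by rewrite (eval_arr (rep_size R) _ (ev _ _ _ _ _ _ _ _ R)) // (rep_y R).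
- by apply: loc_lt (rep_size R) _.
have {}R := rep_set_x v (y v) R.
move: (set_nth _ _ _ _) R => mem1 R.
apply: (wp_Store (a := loc 3 v) (v := Posz (enum_rank (z v)))) => //.
- exact: eval_addr (ev _ _ _ _ _ _ _ _ R).
- by rewrite (eval_arr (rep_size R) _ (ev _ _ _ _ _ _ _ _ R)) // (rep_z R).
- by apply: loc_lt (rep_size R) _.
exists f, o, (upd x1 v (y v)), y, (upd s1 v (z v)), z.
split; first exact: rep_set_s R.
split=> // u ui; rewrite !(@upd_prefix _ _ _ v (enum_rank v)) //.
  by move=> u' /xs[].
by move=> u' /xs[].
Qed.

Lemma wp_init mem f j r o x y s z :
  rep mem f j r o x y s z ->
  wp w inp (For 1 node_count init_node) mem (fun mem' =>
    rep mem' f n r o (fun=> 0) (fun=> 0) id id) (n * 214 + 12).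
Proof.
move=> R.
apply: (@wp_weaken _ _ _ _ _ (fun mem' => exists f1 o1 x1 y1 s1 z1,
    rep mem' f1 n r o1 x1 y1 s1 z1 /\
    [/\ f1 = f, o1 = o & forall u, (enum_rank u < n)%N ->
      [/\ x1 u = 0, y1 u = 0, s1 u = u & z1 u = u]])) (leqnn _) _ _.
  move=> mem' [f1 [o1 [x1 [y1 [s1 [z1 [R1 [fE oE xs]]]]]]]]; subst f1 o1.
  by apply: rep_ext R1 => // u; case: (xs u (ltn_ord _)).
apply: (@wp_inner_loop 200 node_count n init_node r
  (fun i f1 o1 x1 y1 s1 z1 => [/\ f1 = f, o1 = o
      & forall u, (enum_rank u < i)%N ->
      [/\ x1 u = 0, y1 u = 0, s1 u = u & z1 u = u]])) R _ => //.
- exact: D_node.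
- exact: eval_node_count.
move=> i {}mem f1 o1 x1 y1 s1 z1 i_n R [fE oE xs]; subst f1 o1.
have [v iv] := nth_node i_n; subst i.
have ev mem' f' r' o' x' y' s' z' : rep mem' f' (enum_rank v) r' o' x' y' s' z' ->
    eval w inp mem' (var 1) = Some (Posz (enum_rank v)).
  by move=> R'; rewrite (eval_scalar (rep_size R')) // (rep_inner R').
apply: (@wp_Seq _ _ 50 150) => //.
apply: (wp_Store (a := loc 1 v) (v := 0)) => //.
- exact: eval_addr (ev _ _ _ _ _ _ _ _ R).
- by apply: loc_lt (rep_size R) _.
have {}R := rep_set_x v 0 R; move: (set_nth _ _ _ _) R => mem1 R.
apply: (@wp_Seq _ _ 50 100) => //.
apply: (wp_Store (a := loc 2 v) (v := 0)) => //.
- exact: eval_addr (ev _ _ _ _ _ _ _ _ R).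
- by apply: loc_lt (rep_size R) _.
have {}R := rep_set_y v 0 R; move: (set_nth _ _ _ _) R => mem2 R.
apply: (@wp_Seq _ _ 50 50) => //.
apply: (wp_Store (a := loc 3 v) (v := Posz (enum_rank v))) => //.
- exact: eval_addr (ev _ _ _ _ _ _ _ _ R).
- exact: ev R.
- by apply: loc_lt (rep_size R) _.
have {}R := rep_set_s v v R; move: (set_nth _ _ _ _) R => mem3 R.
apply: (wp_Store (a := loc 4 v) (v := Posz (enum_rank v))) => //.
- exact: eval_addr (ev _ _ _ _ _ _ _ _ R).
- exact: ev R.
- by apply: loc_lt (rep_size R) _.
exists f, o, (upd x1 v 0), (upd y1 v 0), (upd s1 v v), (upd z1 v v).
split; first exact: rep_set_z R.
split=> // u ui; split.
- by apply: (@upd_prefix _ _ (fun=> 0) v (enum_rank v)) => // u' /xs[].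
- by apply: (@upd_prefix _ _ (fun=> 0) v (enum_rank v)) => // u' /xs[].
- by apply: (@upd_prefix _ _ id v (enum_rank v)) => // u' /xs[].
- by apply: (@upd_prefix _ _ id v (enum_rank v)) => // u' /xs[].
Qed.

Lemma wp_relax_all r mem f j o x s :
  (forall v, (`|x v| <= D)%N) ->
  rep mem f j r o x x s s ->
  wp w inp relax_all mem
    (fun mem' => exists f y z, rep mem' f m r o x y s z /\ relaxed o x s es y z f)
    (m * 514 + 20).
Proof.
move=> xD R.
apply: (@wp_Seq _ _ 8 (m * 514 + 12)); first lia.
apply: (wp_Store (a := 0) (v := 0)) => //; first by rewrite (rep_size R); lia.
have {}R := rep_set_flag None R; move: (set_nth _ _ _ _) R => mem1 R.
apply: (@wp_weaken _ _ _ _ _ (fun mem' => exists f1 o1 x1 y1 s1 z1,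
    rep mem' f1 m r o1 x1 y1 s1 z1 /\
    [/\ o1 = o, x1 = x, s1 = s & relaxed o x s (take m es) y1 z1 f1])) (leqnn _) _ _.
  move=> mem' [f1 [o1 [x1 [y1 [s1 [z1 [R1 [o1E x1E s1E rx]]]]]]]]; subst o1 x1 s1.
  by exists f1, y1, z1; split=> //; rewrite -size_es take_size in rx.
apply: (@wp_inner_loop 500 edge_count m relax_edge r
  (fun i f1 o1 x1 y1 s1 z1 => [/\ o1 = o, x1 = x, s1 = s
    & relaxed o x s (take i es) y1 z1 f1])) R _ => //.
- exact: D_edge.
- exact: eval_edge_count.
- move=> i {}mem f1 o1 x1 y1 s1 z1 im R [o1E x1E s1E rx]; subst o1 x1 s1.
  have [e [esi eE tk]] := nth_edge im.
  apply: wp_weaken (wp_relax_edge R esi xD) => // mem'; rewrite tk.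
  case: ifPn => [/andP[oe lt]|nlt] R'.
    exists (Some (s e.1)), o, x, (upd y1 e.2 (x e.1 + scaled e)), s,
      (upd z1 e.2 (s e.1)).
    by split=> //; split=> //; apply: relaxed_update rx oe lt.
  by exists f1, o, x, y1, s, z1; split=> //; split=> //; apply: relaxed_skip.
- by rewrite take0; split=> //; apply: relaxed_nil.
Qed.

(** The outcome of a search: a new node to mark, or a certificate that the marking is finished. *)
Definition found_ok o f :=
  if f is Some a then feasible a 0 /\ o a != 0 else exists x, potential o x.

Lemma edge_sub_es : {subset edge G <= es}.
Proof. by move=> e; rewrite mem_es. Qed.

(** The flag is interpreted in round [n] only, where an improvement comes from a walk long enough to
    repeat a node. *)
Lemma wp_bellman_ford_round r mem f j o x s : (r < n)%N ->
  rep mem f j r o x x s s -> shortest_walks o r x s ->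
  wp w inp bellman_ford_round mem (fun mem' => exists f j y z,
    [/\ rep mem' f j r o y y z z, shortest_walks o r.+1 y z
      & r.+1 = n -> found_ok o f]) (m * 514 + n * 114 + 32).
Proof.
move=> rn R sw; have xD v := shortest_walks_bound v (ltnW rn) sw.
apply: (@wp_Seq _ _ (m * 514 + 20) (n * 114 + 12)); first lia.
apply: wp_weaken (wp_relax_all xD R) => // mem1 [f1 [y [z [R1 rx]]]].
apply: wp_weaken (wp_copy R1) => // mem2 R2.
exists f1, n, y, z; split=> //; first exact: shortest_walksS edge_sub_es sw rx.
move=> rn1; case: f1 {R1 R2} rx => [a|] rx /=.
  exact: found_credit0 (esym rn1) sw rx.
by exists x; apply: not_found_potential edge_sub_es rx.
Qed.

Definition search_time := (2000 * (n * m))%N.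

Lemma wp_bellman_ford mem f j r o x y s z :
  rep mem f j r o x y s z ->
  wp w inp bellman_ford mem (fun mem' => exists f j r x y s z,
    rep mem' f j r o x y s z /\ found_ok o f) search_time.
Proof.
move=> R; have nm := edge_ge_node.
apply: (@wp_Seq _ _ (n * 214 + 12) (n * (m * 514 + n * 114 + 32 + 14) + 12)).
  have h1 : (n <= n * m)%N by apply: leq_pmulr; lia.
  have h2 : (n * n <= n * m)%N by rewrite leq_mul2l nm orbT.
  by rewrite /search_time !mulnDr !mulnA; move: h1 h2; rewrite /search_time; lia.
apply: wp_weaken (wp_init R) => // mem1 R1.
apply: (@wp_weaken _ _ _ _ _ (fun mem' => exists f j o1 x y s z,
  rep mem' f j n o1 x y s z /\ [/\ o1 = o, y = x, z = s, shortest_walks o n x s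
    & n = n -> found_ok o f])) (leqnn _) _ _.
  move=> mem2 [f2 [j2 [o2 [x2 [y2 [s2 [z2 [R2 [o2E _ _ _ ok]]]]]]]]].
  by subst o2; exists f2, j2, n, x2, y2, s2, z2; split=> //; apply: ok.
apply: (@wp_outer_loop (m * 514 + n * 114 + 32) bellman_ford_round
  (fun r f o1 x y s z => [/\ o1 = o, y = x, z = s, shortest_walks o r x s
    & r = n -> found_ok o f])) R1 _ => //.
  move=> i mem2 f2 j2 o2 x2 y2 s2 z2 i_n R2 [oE yE zE sw _]; subst o2 y2 z2.
  apply: wp_weaken (wp_bellman_ford_round i_n R2 sw) => //.
  move=> mem3 [f3 [j3 [y3 [z3 [R3 sw3 ok3]]]]].
  by exists f3, j3, o, y3, y3, z3, z3.
split=> //; first exact: shortest_walks0.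
(* Before the first round the clause on the flag is vacuous, since [n] is positive. *)
by move=> n0; move: G_gt0; rewrite -n0.
Qed.

(** * The marking loop *)

Definition marks o := forall v, o v = 1 \/ (o v = 0 /\ feasible v 0).

Definition marked_count o := #|[set v | o v == 0]|.

Definition credit0_count := #|[set v : V | credit v == Some 0]|.

Lemma marked_le o : marks o -> (marked_count o <= credit0_count)%N.
Proof.
move=> ok; apply: subset_leq_card; apply/subsetP => v; rewrite !inE => /eqP ov.
by case: (ok v) => [|[_ /credit0->//]]; rewrite ov.
Qed.

Lemma marked_upd o a : o a != 0 -> (marked_count o < marked_count (upd o a 0))%N.
Proof.
move=> oa; apply/proper_card/properP; split.
  by apply/subsetP => v; rewrite !inE /upd; case: (v == a).
by exists a; rewrite !inE /upd ?eqxx.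
Qed.

Lemma marks_upd o a : marks o -> feasible a 0 -> marks (upd o a 0).
Proof.
by move=> ok fa v; rewrite /upd; case: eqP => [->|_]; [right | apply: ok].
Qed.

Lemma wp_mark_found mem f j r o x y s z : rep mem f j r o x y s z ->
  wp w inp mark_found mem (fun mem' =>
    rep mem' f j r (if f is Some a then upd o a 0 else o) x y s z) 100.
Proof.
move=> R; have := D_word; have := D_gt0; have := D_node => *.
apply: (@wp_If _ _ 50 _ _ _ _ (flag f)) => //.
  by rewrite (eval_scalar (rep_size R)) // (rep_flag R).
case: f R => [a|] R /=; last exact: wp_Skip.
have : (enum_rank a < n)%N := ltn_ord _ => *.
apply: (wp_Store (a := loc 0 a) (v := 0)) => //.
- apply: eval_addr => //.
  rewrite (eval_Bin (eval_scalar (rep_size R) _) (@eval_small mem 1 isT)) // (rep_flag R) /eval_binop /flag.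
    by congr Some; lia.
  by lia.
- by apply: loc_lt (rep_size R) _.
- exact: rep_set_o R.
Qed.

(** [d] bounds the remaining searches: each successful one marks a new node, and at most
    [credit0_count] nodes can be marked. The 103 pays for the marking and the loop test. *)
Lemma wp_mark_loop d mem f j r o x y s z :
  (credit0_count < d + marked_count o)%N -> marks o ->
  (f = None -> exists p, potential o p) -> rep mem f j r o x y s z ->
  wp w inp (While (var 0) (Seq bellman_ford mark_found)) mem (fun mem' =>
    exists f j r o x y s z p,
      [/\ rep mem' f j r o x y s z, marks o & potential o p])
    (d * (search_time + 103) + 3).
Proof.
elim: d mem f j r o x y s z => [|d IH] mem f j r o x y s z dk ok fN R.
  by have := marked_le ok; lia.
have ef : eval w inp mem (var 0) = Some (flag f).
  by rewrite (eval_scalar (rep_size R)) // (rep_flag R).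
case: f fN R ef => [a|] fN R ef; last first.
  have [p pot] := fN erefl; apply: wp_WhileF ef _; first by rewrite /=; lia.
  by exists None, j, r, o, x, y, s, z, p.
apply: (@wp_WhileT _ _ (search_time + 100) (d * (search_time + 103) + 3)) ef _ _ => //.
  by rewrite /=; lia.
apply: (@wp_Seq _ _ search_time 100) => //.
apply: wp_weaken (wp_bellman_ford R) => //.
move=> mem1 [f1 [j1 [r1 [x1 [y1 [s1 [z1 [R1 fok]]]]]]]].
apply: wp_weaken (wp_mark_found R1) => // mem2 R2.
case: f1 fok R1 R2 => [b|] fok _ R2.
  have [fb ob] := fok; apply: IH R2 => //; last exact: marks_upd.
  by apply: leq_trans dk _; rewrite addSn -addnS leq_add2l; apply: marked_upd.
have [p pot] := fok; apply: wp_WhileF; first by rewrite /=; lia.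
  by rewrite (eval_scalar (rep_size R2)) // (rep_flag R2).
by exists None, j1, r1, o, x1, y1, s1, z1, p.
Qed.

Lemma wp_mark_all mem f j r o x y s z : o =1 (fun=> 1) ->
  rep mem f j r o x y s z ->
  wp w inp mark_all mem (fun mem' => exists f j r o x y s z p,
      [/\ rep mem' f j r o x y s z, marks o & potential o p])
    (credit0_count.+1 * (search_time + 103) + 10).
Proof.
(* The initial flag 1 reads as if the node of rank 0 had been found, so the loop is entered and its
   clause on [None] is vacuous. *)
move=> o1 R; pose v0 := enum_val (Ordinal G_gt0).
have v0E : flag (Some v0) = 1 by rewrite /flag enum_valK.
apply: (@wp_Seq _ _ 7 (credit0_count.+1 * (search_time + 103) + 3)); first lia.
apply: (wp_Store (a := 0) (v := 1)) => //.
- by rewrite eval_small.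
- by rewrite (rep_size R); lia.
rewrite -v0E; apply: wp_mark_loop (rep_set_flag (Some v0) R) => //; first lia.
by move=> v; left.
Qed.

(** * Credit relaxation on the machine *)

Lemma eval_credit_candidate i e mem f r o x y s z :
  rep mem f i r o x y s z -> onth es i = Some e ->
  (forall v, (`|o v| <= D.+1)%N) ->
  eval w inp mem credit_candidate = Some (candidate o e).
Proof.
move=> R esi oD; have [e1 e2 e3] := eval_edge (rep_size R) (rep_inner R) esi.
have eE : e \in edge G by rewrite -mem_es; apply/onthP; exists i.
have := D_word; have := D_gt0; have := D_weight.
have := oD e.2; have := wt_le eE => *.
have eo : eval w inp mem (arr 0 dst) = Some (o e.2).
  by rewrite (eval_arr (rep_size R) _ e2) // (rep_o R).
have ed : eval w inp mem (Bin Defs.Sub (arr 0 dst) weight) = Some (o e.2 - wt e).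
  by rewrite (eval_Bin eo e3) /eval_binop //; lia.
have elt := eval_Bin (o := Lt) ed (@eval_small mem 0 isT).
rewrite (eval_Bin ed (elt _)) /eval_binop /candidate; case: ltP => /= *.
all: rewrite ?mulr0 ?mulr1 //; try congr Some; lia.
Qed.

Lemma wp_relax_credit i e mem f r o x y s z :
  rep mem f i r o x y s z -> onth es i = Some e ->
  (forall v, (`|o v| <= D.+1)%N) ->
  wp w inp relax_credit mem (fun mem' =>
    rep mem' f i r (if improves o e then upd o e.1 (candidate o e) else o)
      x y s z) 500.
Proof.
move=> R esi oD; have [e1 e2 _] := eval_edge (rep_size R) (rep_inner R) esi.
have := D_word; have := D_gt0 => *.
have boolw (b : bool) : (`|Posz b| <= w)%N by case: b => /=; lia.
apply: (@wp_If _ _ 200 _ _ _ _ (int_of_bool (improves o e))) => //.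
  have eo1 : eval w inp mem (arr 0 src) = Some (o e.1).
    by rewrite (eval_arr (rep_size R) _ e1) // (rep_o R).
  have eo2 : eval w inp mem (arr 0 dst) = Some (o e.2).
    by rewrite (eval_arr (rep_size R) _ e2) // (rep_o R).
  have el1 := eval_Bin (o := Lt) eo2 (@eval_small mem 1 isT) (boolw _).
  have el2 := eval_Bin (o := Lt) (@eval_small mem 0 isT) eo1 (boolw _).
  have el3 := eval_Bin (o := Lt) eo1 (eval_credit_candidate R esi oD) (boolw _).
  have eor := eval_Bin (o := Or) el2 el3 (boolw _).
  rewrite (eval_Bin (o := And) el1 eor (boolw _)) /improves /=.
  by case: (_ < 1); case: (0 < _); case: (_ < candidate _ _).
case: (improves o e) => /=; last exact: wp_Skip.
apply: (wp_Store _ (eval_addr _ e1) (eval_credit_candidate R esi oD)) => //.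
  by apply: loc_lt (rep_size R) _.
exact: rep_set_o R.
Qed.

(** The bound on the values grows by [max_weight G] per edge rather than per round, because updates
    are in place; the summand 1 allows for the code of -oo. *)
Lemma wp_credit_round marked r mem f j o x y s z : (r < n)%N ->
  rep mem f j r o x y s z -> sound o -> complete_upto marked r o ->
  (forall v, (`|o v| <= r * m * max_weight G + 1)%N) ->
  wp w inp (For 1 edge_count relax_credit) mem (fun mem' =>
    exists f o x y s z, rep mem' f m r o x y s z /\
    [/\ sound o, complete_upto marked r.+1 o
      & forall v, (`|o v| <= r.+1 * m * max_weight G + 1)%N])
  (m * 514 + 12).
Proof.
move=> rn R so co ob.
apply: (@wp_weaken _ _ _ _ _ (fun mem' => exists f1 o1 x1 y1 s1 z1,
    rep mem' f1 m r o1 x1 y1 s1 z1 /\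
    [/\ sound o1, relaxed_credit o (take m es) o1
      & forall v, (`|o1 v| <= (r * m + m) * max_weight G + 1)%N])) (leqnn _) _ _.
  move=> mem' [f1 [o1 [x1 [y1 [s1 [z1 [R1 [so1 rx ob1]]]]]]]].
  exists f1, o1, x1, y1, s1, z1; rewrite mulSnr; split=> //; split=> //.
  by rewrite -size_es take_size in rx; apply: complete_uptoS edge_sub_es co rx.
apply: (@wp_inner_loop 500 edge_count m relax_credit r
  (fun i f1 o1 x1 y1 s1 z1 => [/\ sound o1, relaxed_credit o (take i es) o1
      & forall v, (`|o1 v| <= (r * m + i) * max_weight G + 1)%N])) R _ => //.
- exact: D_edge.
- exact: eval_edge_count.
- move=> i {}mem f1 o1 x1 y1 s1 z1 im R [so1 rx ob1].
  have [e [esi eE tk]] := nth_edge im.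
  have oD v : (`|o1 v| <= D.+1)%N.
    apply: leq_trans (ob1 v) _; rewrite addn1 ltnS; apply: leq_trans D_rounds.
    rewrite leq_mul2r; apply/orP; right.
    apply: (@leq_trans (r * m + m)); first by rewrite leq_add2l ltnW.
    by rewrite -mulSnr leq_mul2r rn orbT.
  apply: wp_weaken (wp_relax_credit R esi oD) => // mem' R'.
  do 6! eexists; split; first exact: R'.
  have cb := candidate_bound eE ob1.
  case: ifPn => imp.
    split; first exact: sound_update.
      by rewrite tk; apply: relaxed_credit_update.
    move=> v; rewrite /upd [(r * m + i.+1)%N]addnS mulSn; case: eqP => _.
      by move: cb; move: (_ * _)%N; lia.
    by have := ob1 v; move: (_ * _)%N; lia.
  split=> //; first by rewrite tk; apply: relaxed_credit_skip.
  by move=> v; have := ob1 v; rewrite [(r * m + i.+1)%N]addnS mulSn; move: (_ * _)%N; lia.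
- by rewrite take0 addn0; split=> //; apply: relaxed_credit_nil.
Qed.

Lemma wp_credit_rounds mem f j r o x y s z p :
  rep mem f j r o x y s z -> marks o -> potential o p ->
  wp w inp (For 2 node_count (For 1 edge_count relax_credit)) mem (fun mem' =>
    forall u : V, onth mem' (3 + enum_rank u) = Some (output_word (credit u)))
  (n * (m * 514 + 26) + 12).
Proof.
move=> R ok pot; apply: (@wp_weaken _ _ _ _ _ (fun mem' => exists f1 j1 o1 x1 y1 s1 z1,
    rep mem' f1 j1 n o1 x1 y1 s1 z1 /\
    [/\ sound o1, complete_upto o n o1
      & forall v, (`|o1 v| <= n * m * max_weight G + 1)%N])) (leqnn _) _ _.
  move=> mem' [f1 [j1 [o1 [x1 [y1 [s1 [z1 [R1 [so co _]]]]]]]]] u.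
  rewrite (complete_credit pot so co) -(rep_o R1).
  have lt : (3 + enum_rank u < size mem')%N.
    by have := @loc_lt mem' 0 u (rep_size R1) isT; rewrite /loc; lia.
  rewrite onthE (nth_map 0) //; congr Some; congr nth.
apply: (@wp_outer_loop (m * 514 + 12) _
  (fun r f1 o1 x1 y1 s1 z1 => [/\ sound o1, complete_upto o r o1
      & forall v, (`|o1 v| <= r * m * max_weight G + 1)%N])) R _ => //.
- by lia.
- move=> i mem2 f2 j2 o2 x2 y2 s2 z2 i_n R2 [so co ob].
  apply: wp_weaken (wp_credit_round i_n R2 so co ob) => //.
  move=> mem3 [f3 [o3 [x3 [y3 [s3 [z3 [R3 I3]]]]]]].
  by exists f3, m, o3, x3, y3, s3, z3.
(* The marks serve as initial credits: 0 on marked nodes and the code 1 of -oo elsewhere. *)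
split; [|exact: complete_upto0|].
  by move=> v; case: (ok v) => [|[-> fv]]; [left | right].
by move=> v; case: (ok v) => [->|[->]].
Qed.

(** * The whole program *)

Lemma wp_unmark mem f j r o x y s z :
  rep mem f j r o x y s z ->
  wp w inp (For 1 node_count (Store (addr 0 (var 1)) (Const 1))) mem
    (fun mem' => rep mem' f n r (fun=> 1) x y s z) (n * 114 + 12).
Proof.
move=> R.
apply: (@wp_weaken _ _ _ _ _ (fun mem' => exists f1 o1 x1 y1 s1 z1,
    rep mem' f1 n r o1 x1 y1 s1 z1 /\
    [/\ f1 = f, x1 = x, y1 = y, s1 = s & z1 = z /\
     forall u, (enum_rank u < n)%N -> o1 u = 1])) (leqnn _) _ _.
  move=> mem' [f1 [o1 [x1 [y1 [s1 [z1 [R1 [fE xE yE sE [zE xs]]]]]]]]].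
  subst f1 x1 y1 s1 z1.
  by apply: rep_ext R1 => // u; apply: xs; apply: ltn_ord.
apply: (@wp_inner_loop 100 node_count n _ r
  (fun i f1 o1 x1 y1 s1 z1 => [/\ f1 = f, x1 = x, y1 = y, s1 = s & z1 = z /\
     forall u, (enum_rank u < i)%N -> o1 u = 1])) R _ => //.
- exact: D_node.
- exact: eval_node_count.
move=> i {}mem f1 o1 x1 y1 s1 z1 i_n R [fE xE yE sE [zE xs]].
subst f1 x1 y1 s1 z1.
have [v iv] := nth_node i_n; subst i.
apply: (wp_Store (a := loc 0 v) (v := 1)) => //.
- apply: eval_addr => //.
  by rewrite (eval_scalar (rep_size R)) // (rep_inner R).
- by rewrite eval_small.
- by apply: loc_lt (rep_size R) _.
exists f, (upd o1 v 1), x, y, s, z.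
split; first exact: rep_set_o R.
split=> //; split=> // u ui.
by apply: (@upd_prefix _ _ (fun=> 1) v (enum_rank v)).
Qed.

(** In zeroed memory the source arrays read as constantly the node of rank 0. *)
Lemma rep_init v0 : enum_rank v0 = 0%N :> nat ->
  rep (nseq (8 * n) 0) None 0 0 (fun=> 0) (fun=> 0) (fun=> 0)
    (fun=> v0) (fun=> v0).
Proof.
by move=> v0E; split=> [||||v|v|v|v|v]; rewrite ?size_nseq // nth_nseq ?v0E if_same.
Qed.

(** At most [k] searches of order [n * m] dominate; the other phases cost order [n * m] once and are
    absorbed as [k >= 1]. *)
Lemma wp_credit_program :
  wp w inp credit_program (nseq (8 * n) 0) (fun mem' =>
    forall u : V, onth mem' (3 + enum_rank u) = Some (output_word (credit u)))
  (4000 * ((credit0_count + 1) * n * m)).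
Proof.
have nm := edge_ge_node.
have h1 : (n <= n * m)%N by apply: leq_pmulr; lia.
apply: (@wp_Seq _ _ (n * 114 + 12) ((credit0_count.+1 * (search_time + 103) + 10) +
  (n * (m * 514 + 26) + 12))).
  have : (n * m <= credit0_count.+1 * (n * m))%N by apply: leq_pmull.
  have : (credit0_count.+1 <= credit0_count.+1 * (n * m))%N by apply: leq_pmulr; lia.
  by rewrite /search_time addn1; move: h1; move: n m credit0_count; nia.
apply: wp_weaken (wp_unmark (rep_init (v0 := enum_val (Ordinal G_gt0)) _)) => //.
  move=> mem1 R1; apply: wp_Seq (leqnn _) _.
  apply: wp_weaken (wp_mark_all _ R1) => //.
  move=> mem2 [f [j [r [o [x [y [s [z [p [R2 ok pot]]]]]]]]]].
  exact: wp_credit_rounds R2 ok pot.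
by rewrite enum_valK.
Qed.

End Correctness.

Local Close Scope ring_scope.

Theorem theorem6 :
  exists (prog : cmd) (out ct cs cw : nat),
  forall (G : wgraph) (es : seq (node G * node G)),
    (0 < #|node G|)%N ->
    perm_eq es (enum (edge G)) ->
    let n := #|node G| in
    let m := #|edge G| in
    let k := (#|[set v : node G | credit v == Some 0%R]| + 1)%N in
    exists (mem : seq int) (t : nat),
      [/\ exec (word_bound G cw) (input_words es) prog
            (nseq (cs * n) 0%R) mem t,
          (t <= ct * (k * n * m))%N
        & forall u : node G,
            onth mem (out + enum_rank u) = Some (output_word (credit u))].
Proof.
(* The credits start after the three scalars; the first [8] counts memory words per node, the second
   is the exponent of the word bound. *)
exists credit_program, 3%N, 4000%N, 8%N, 8%N => G es G_gt0 esP n m k.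
have [mem [t [run tt res]]] := wp_credit_program G_gt0 esP.
by exists mem, t.
Qed.
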